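(* Let $f:(0,1/2]\to\mathbb{R}$ be a decreasing function. Then $f\in\overline{\mathcal{F}}$ if and only if $f(1/2)=1$ and $$f(\alpha)\le\frac{1}{\alpha}\qquad\text{for all }\alpha\in(0,1/2).$$
   Context: For an irreducible discrete-time Markov chain $X=(X_t)_{t\ge 0}$ with finite state space $\Omega$ and stationary distribution $\pi$, the hitting time of $A\subseteq\Omega$ is $\tau_A=\min\{t: X_t\in A\}$, and $\mathbb{E}_x$ denotes expectation for the chain started at $X_0=x$. For $\alpha\in(0,1)$, $$T(\alpha)=\max\{\mathbb{E}_x[\tau_A] : x\in\Omega,\ A\subseteq\Omega,\ \pi(A)\ge\alpha\}.$$ ''Decreasing'' means non-increasing (step functions are allowed). $\mathcal{F}$ denotes the set of decreasing functions $f:(0,1/2]\to\mathbb{R}$ given by $f(\alpha)=T(\alpha)/T(1/2)$ for some irreducible finite Markov chain (on at least two states). $\overline{\mathcal{F}}$ denotes the set of decreasing functions $f:(0,1/2]\to\mathbb{R}$ each of which may be obtained as the almost everywhere pointwise limit of (a sequence of) functions in $\mathcal{F}$.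
   Formalization: The closure of F is taken with almost everywhere convergence on (0,1/2) plus convergence at the endpoint 1/2; as printed, f = 1 on (0,1/2) with f(1/2) = 0 would be an a.e. limit of profiles violating f(1/2) = 1. *)

(* Defs.v *)
From HB Require Import structures.
From mathcomp Require Import all_boot all_order all_algebra.
From mathcomp Require Import all_classical all_reals all_analysis.

Set Implicit Arguments.
Unset Strict Implicit.
Unset Printing Implicit Defensive.

Import Order.TTheory GRing.Theory Num.Theory.
Import numFieldNormedType.Exports.

Local Open Scope classical_set_scope.
Local Open Scope ring_scope.

(* A time-homogeneous Markov chain (X_t) on a finite state space, realised on
   one sample space carrying all the laws P_x of the chain started at x.
   [proc_markov] is the Markov property
     P_x(X_{t+1} = y_{t+1} | X_0 = y_0, ..., X_t = y_t) = p(y_t, y_{t+1})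
   multiplied out, so that null conditioning events need no convention. *)
Record markov_chain (R : realType) := MarkovChain {
  state : finType;
  trans : state -> state -> R;
  trans_ge0 : forall x y, 0 <= trans x y;
  trans_sum1 : forall x, \sum_y trans x y = 1;
  sample_display : measure_display;
  sample : measurableType sample_display;
  law : state -> probability sample R;
  proc : nat -> sample -> state;
  proc_measurable : forall t y, measurable [set w | proc t w = y];
  proc_start : forall x, law x [set w | proc 0%N w = x] = 1%E;
  proc_markov : forall x t (y : nat -> state),
    law x [set w | forall s, (s <= t.+1)%N -> proc s w = y s] =
    (law x [set w | forall s, (s <= t)%N -> proc s w = y s]
       * (trans (y t) (y t.+1))%:E)%E }.

Arguments trans {R} m.
Arguments law {R} m.
Arguments proc {R} m.

Definition irreducible (R : realType) (C : markov_chain R) : Prop :=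
  forall x y : state C,
    exists t : nat, (0 < law C x [set w | proc C t w = y])%E.

Definition stationary (R : realType) (C : markov_chain R)
    (pi : state C -> R) : Prop :=
  [/\ forall x, 0 <= pi x,
      \sum_x pi x = 1
    & forall y, \sum_x pi x * trans C x y = pi y].

(* tau_A; the infimum is a minimum when A is hit, and +oo otherwise. *)
Definition hitting_time (R : realType) (C : markov_chain R)
    (A : {set state C}) (w : sample C) : \bar R :=
  ereal_inf [set (t%:R)%:E | t in [set t : nat | proc C t w \in A]].

Definition expected_hitting_time (R : realType) (C : markov_chain R)
    (x : state C) (A : {set state C}) : \bar R :=
  (\int[law C x]_w hitting_time A w)%E.

(* T(alpha); for alpha <= 1 the family is nonempty (take A = Omega), so the
   default value -oo is not reached. *)
Definition max_hitting_time (R : realType) (C : markov_chain R)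
    (pi : state C -> R) (alpha : R) : \bar R :=
  \big[maxe/-oo%E]_(x : state C)
    \big[maxe/-oo%E]_(A : {set state C} | alpha <= \sum_(y in A) pi y)
      expected_hitting_time x A.

(* Functions (0,1/2] -> R are represented by functions R -> R of which only the
   values on ]0, 1/2] are ever mentioned. *)
Definition decreasing_half (R : realType) (f : R -> R) : Prop :=
  forall a b : R, 0 < a -> a <= b -> b <= 2^-1 -> f b <= f a.

(* T is finite and T(1/2) > 0 for an irreducible chain on at least two states,
   so [fine] loses nothing. *)
Definition hitting_profile (R : realType) (f : R -> R) : Prop :=
  decreasing_half f /\
  exists (C : markov_chain R) (pi : state C -> R),
    [/\ (1 < #|state C|)%N, irreducible C, stationary pi
      & forall a : R, 0 < a -> a <= 2^-1 ->
          f a = fine (max_hitting_time pi a) / fine (max_hitting_time pi 2^-1)].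

(* Every profile takes the value 1 at 1/2. The exceptional null set is taken
   inside the open interval: if it could contain the endpoint, then f(1/2)
   could be lowered arbitrarily without affecting membership. *)
Definition hitting_profile_closure (R : realType) (f : R -> R) : Prop :=
  decreasing_half f /\
  exists g : nat -> R -> R,
    [/\ forall n, hitting_profile (g n),
        {ae (@lebesgue_measure R), forall a : R,
          0 < a < 2^-1 -> (fun n => g n a) @ \oo --> f a}
      & (fun n => g n 2^-1) @ \oo --> f 2^-1].

(* Main.v *)
From HB Require Import structures.
Require Import Defs.
From mathcomp Require Import all_boot all_order all_algebra.
From mathcomp Require Import all_classical all_reals all_analysis.
From mathcomp Require Import measurable_realfun zify ring lra.

Set Implicit Arguments.
Unset Strict Implicit.
Unset Printing Implicit Defensive.

Import Order.TTheory GRing.Theory Num.Theory.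
Import numFieldNormedType.Exports.
Local Open Scope ring_scope.

(** A profile is bounded by 1/a, that is, T(a) <= T(1/2)/a. Let A have mass at
    least a, let h be its expected hitting time, and let B be the set where
    h > (1/a - 1) T(1/2). If B had mass at least 1/2, then every state of A would
    reach B in mean time at most T(1/2), while every state of B needs more than
    (1/a - 1) T(1/2) to reach A. The stationary chain alternates between
    journeys from A to B and journeys from B to A, and visits A only during the
    first kind, so A would have mass less than a ([phase_comparison]). Hence
    the complement of B has mass more than 1/2; it is reached from anywhere in
    mean time T(1/2), and from it A is reached in mean time at most
    (1/a - 1) T(1/2) ([hit_le_half]). The bound passes to almost everywhere
    limits at every point because the limit is decreasing ([closure_bounds]).

    Conversely, let al_0 = 1 > al_1 > ... > al_k > al_(k+1) = 0 with al_1 < 1/2,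
    and let 1 = phi_0 < ... < phi_k satisfy phi_i al_i <= 1. There is a chain on
    0, ..., k in which the states from i on have total mass al_i, every state
    other than 0 jumps to 0 at rate 1, and apart from these resets only moves to
    neighbours occur, so that the chain started at 0 first reaches a set
    avoiding 0 at the smallest element of that set. Call i that element: in
    units of T(1/2) the set is reached within phi_i from everywhere. The flow
    from i back to i-1 that makes this true is (1 - phi_i al_i) / (phi_i -
    phi_(i-1)), and its being nonnegative is exactly the bound phi_i <= 1 /
    al_i. With phi_k al_k = 1 the last state has no other way out than the
    reset, so starting there costs a full T(1/2) to reach 0 and phi_i is
    attained ([path_profile]). Taking for phi_i a convex combination of f(al_i)
    and 1/al_i on a fine grid sandwiches the profile between values of f near a
    ([exists_approx]), which gives convergence wherever f is right continuous,
    hence off a countable set ([bounds_closure]).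

    Both halves read hitting times off the transition matrix. The events that
    describe the first n steps have probabilities given by iterated averages
    ([law_stays]), so the expected hitting time is a series of survival
    probabilities ([expected_hitting_timeE]); bounds on it come from functions
    v with 1 + P v <= v or v <= 1 + P v off the target
    ([hit_le_super], [sub_le_hit]). *)

(** * Hitting times of a stochastic matrix *)

Section Kernel.
Context {R : realType} {S : finType}.
Variable p : S -> S -> R.
Hypothesis p_ge0 : forall x y, 0 <= p x y.
Hypothesis p_sum1 : forall x, \sum_y p x y = 1.

Implicit Types (A B : {set S}) (v w : S -> R) (x y : S).

Definition avg (v : S -> R) (x : S) : R := \sum_y p x y * v y.

Lemma avg_cst c x : avg (fun=> c) x = c.
Proof. by rewrite /avg -mulr_suml p_sum1 mul1r. Qed.

Lemma avgD v w x : avg (fun y => v y + w y) x = avg v x + avg w x.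
Proof. by rewrite /avg -big_split; apply: eq_bigr => y _; rewrite mulrDr. Qed.

Lemma avgZ c v x : avg (fun y => c * v y) x = c * avg v x.
Proof. by rewrite /avg mulr_sumr; apply: eq_bigr => y _; rewrite mulrCA. Qed.

Lemma avg_sum (I : Type) (r : seq I) (v : I -> S -> R) x :
  avg (fun y => \sum_(i <- r) v i y) x = \sum_(i <- r) avg (v i) x.
Proof.
rewrite /avg exchange_big; apply: eq_bigr => y _.
by rewrite mulr_sumr.
Qed.

Lemma avg_le v w x : (forall y, v y <= w y) -> avg v x <= avg w x.
Proof. by move=> vw; apply: ler_sum => y _; rewrite ler_wpM2l. Qed.

Lemma avg_ge0 v x : (forall y, 0 <= v y) -> 0 <= avg v x.
Proof. by move=> v0; apply: sumr_ge0 => y _; rewrite mulr_ge0. Qed.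

Lemma cvg_avg (v : nat -> S -> R) (w : S -> R) x :
  (forall y, (fun n => v n y) @ \oo --> w y)%classic ->
  ((fun n => avg (v n) x) @ \oo --> avg w x)%classic.
Proof.
move=> vw; rewrite /avg; apply: cvg_big => [|y _].
  exact: add_continuous.
by apply: cvgMl_tmp; exact: vw.
Qed.

(** The probability, for the chain started at x, that the i-th state lies in D
    i for every i <= m. *)
Fixpoint stays (D : nat -> {set S}) (m : nat) (x : S) : R :=
  (x \in D 0)%:R * if m is k.+1 then avg (stays (fun i => D i.+1) k) x else 1.

(** The probability that A has not been visited by time n. *)
Definition survival (A : {set S}) : nat -> S -> R := stays (fun=> ~: A).

Lemma survival0 A x : survival A 0 x = (x \notin A)%:R.
Proof. by rewrite /survival /= finset.in_setC mulr1. Qed.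

Lemma survivalS A n x :
  survival A n.+1 x = (x \notin A)%:R * avg (survival A n) x.
Proof. by rewrite /survival /= finset.in_setC. Qed.

Lemma survival_in A n x : x \in A -> survival A n x = 0.
Proof. by case: n => [|n] xA; rewrite ?survival0 ?survivalS xA ?mul0r. Qed.

Lemma survival_ge0 A n x : 0 <= survival A n x.
Proof.
elim: n x => [|n IH] x; first by rewrite survival0 ler0n.
by rewrite survivalS mulr_ge0 ?ler0n ?avg_ge0.
Qed.

Lemma survival_le1 A n x : survival A n x <= 1.
Proof.
elim: n x => [|n IH] x; first by rewrite survival0 lern1 leq_b1.
rewrite survivalS mulr_ile1 ?ler0n ?avg_ge0 ?lern1 ?leq_b1//.
  by move=> y; exact: survival_ge0.
by rewrite -[leRHS](avg_cst 1 x); exact: avg_le.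
Qed.

Lemma survivalS_le A n x : survival A n.+1 x <= survival A n x.
Proof.
elim: n x => [|n IH] x.
  rewrite survivalS survival0 ler_piMr ?ler0n//.
  rewrite -[leRHS](avg_cst 1 x); apply: avg_le => y; exact: survival_le1.
by rewrite survivalS [leRHS]survivalS ler_wpM2l ?ler0n//; exact: avg_le.
Qed.

Lemma survival_le A m n x :
  (m <= n)%N -> survival A n x <= survival A m x.
Proof.
move=> /subnK <-; elim: (n - m)%N => // k IH.
by rewrite addSn (le_trans (survivalS_le _ _ _)).
Qed.

Lemma survival_subset A B n x :
  A \subset B -> survival B n x <= survival A n x.
Proof.
move=> AB; have H y : (y \notin B)%:R <= (y \notin A)%:R :> R.
  rewrite ler_nat; case: (boolP (y \in B)) => //= yB.
  by rewrite (contra (fintype.subsetP AB y)).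
elim: n x => [|n IH] x; first by rewrite !survival0.
rewrite !survivalS ler_pM ?ler0n ?avg_ge0//; last exact: avg_le.
by move=> y; exact: survival_ge0.
Qed.

(** The expectation of min(n, hitting time of A). *)
Definition truncated (A : {set S}) (n : nat) (x : S) : R :=
  \sum_(0 <= t < n) survival A t x.

Lemma truncated_in A n x : x \in A -> truncated A n x = 0.
Proof. by move=> xA; rewrite /truncated big1// => t _; rewrite survival_in. Qed.

Lemma truncatedS A n x : x \notin A ->
  truncated A n.+1 x = 1 + avg (truncated A n) x.
Proof.
move=> xA; rewrite /truncated big_nat_recl// survival0 xA avg_sum; congr (_ + _).
by apply: eq_bigr => t _; rewrite survivalS xA mul1r.
Qed.

Lemma truncated_ge0 A n x : 0 <= truncated A n x.
Proof. by apply: sumr_ge0 => t _; exact: survival_ge0. Qed.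

Lemma truncated_le A m n x :
  (m <= n)%N -> truncated A m x <= truncated A n x.
Proof.
move=> mn; rewrite /truncated [leRHS](big_cat_nat (leq0n m) mn) lerDl.
by apply: sumr_ge0 => t _; exact: survival_ge0.
Qed.

(** A function v with 1 + P v <= v off A starts above the truncated
    expectations at n = 0, and their recursion in n is monotone, so it stays
    above them. *)
Lemma truncated_le_super A (v : S -> R) n x :
  (forall x, 0 <= v x) ->
  (forall x, x \notin A -> 1 + avg v x <= v x) ->
  truncated A n x <= v x.
Proof.
move=> v0 sup; elim: n x => [|n IH] x; first by rewrite /truncated big_nil.
have [xA|xA] := boolP (x \in A); first by rewrite truncated_in.
rewrite truncatedS// (le_trans _ (sup _ xA))// lerD2l; exact: avg_le.
Qed.

(** On trajectories that have not met A after n steps the subsolution v is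
    only known to be at most M; those trajectories have probability [survival
    A n x]. *)
Lemma sub_le_truncated A (v : S -> R) M n x :
  (forall x, x \in A -> v x <= 0) ->
  (forall x, v x <= M) ->
  (forall x, x \notin A -> v x <= 1 + avg v x) ->
  v x <= truncated A n.+1 x + M * survival A n x.
Proof.
move=> vA vM sub; elim: n x => [|n IH] x.
  have [xA|xA] := boolP (x \in A).
    by rewrite truncated_in// survival_in// mulr0 addr0 vA.
  rewrite truncatedS// survival0 xA mulr1 (le_trans (sub _ xA))//.
  rewrite -addrA lerD2l -[leLHS]add0r lerD ?avg_ge0//.
    by move=> y; exact: truncated_ge0.
  by rewrite -[leRHS](avg_cst M x); exact: avg_le.
have [xA|xA] := boolP (x \in A).
  by rewrite truncated_in// survival_in// mulr0 addr0 vA.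
rewrite truncatedS// survivalS xA mul1r -addrA (le_trans (sub _ xA))// lerD2l.
by rewrite -avgZ -avgD; exact: avg_le.
Qed.

Definition hit (A : {set S}) (x : S) : R := limn (fun n => truncated A n x).

(** The set A is reached with positive probability from every state. *)
Definition transient_off (A : {set S}) :=
  forall x, exists t, survival A t x < 1.

Lemma transient_off_subset A B :
  A \subset B -> transient_off A -> transient_off B.
Proof.
move=> AB TA x; have [t] := TA x; exists t.
by rewrite (le_lt_trans (survival_subset _ _ AB)).
Qed.

(** As there are finitely many states, the survival probabilities at one
    common time N are at most some q < 1. Then the expectation truncated at N,
    divided by 1 - q, satisfies the hypothesis of [truncated_le_super]. *)
Lemma truncated_bounded A : transient_off A ->
  exists M, forall n x, truncated A n x <= M.
Proof.
move=> TA; have [t tP] := choice TA.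
pose N := \max_x t x.
pose q := \big[Num.max/0]_x survival A N x.
have q1 : q < 1.
  rewrite /q; apply/bigmax_ltP; split => // x _.
  by rewrite (le_lt_trans _ (tP x))// survival_le// leq_bigmax.
have qP x : survival A N x <= q by exact: le_bigmax.
have d0 : 0 < 1 - q by rewrite subr_gt0.
pose v x := (1 - q)^-1 * truncated A N x.
have vE n x : truncated A n x <= v x.
  apply: truncated_le_super => [y|y yA].
    by rewrite mulr_ge0 ?truncated_ge0// invr_ge0 ltW.
  rewrite /v avgZ -(ler_pM2l d0) mulrDr !mulVKf ?lt0r_neq0// mulr1.
  have := truncatedS N yA; rewrite {1}/truncated big_nat_recr//= -/(truncated _ _ _).
  by have := qP y; lra.
exists (\big[Num.max/0]_x v x) => n x.
by rewrite (le_trans (vE n x))//; exact: le_bigmax.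
Qed.

(** A state that never reaches A survives with probability 1 at all times, so
    its truncated expectations grow without bound. *)
Lemma bounded_transient_off A :
  (forall x, exists M, forall n, truncated A n x <= M) -> transient_off A.
Proof.
move=> bnd x; have [M MP] := bnd x; apply: contrapT => /forallNP no.
have := MP (Num.truncn M).+1; apply/negP; rewrite -ltNge.
rewrite (lt_le_trans (truncnS_gt M))//.
rewrite -[leLHS]addr0 -[X in X%:R + _]subn0 -sumr_const_nat addr0.
apply: ler_sum => t _; rewrite leNgt; apply/negP; exact: no.
Qed.

Lemma truncated_cvg A x : transient_off A ->
  ((fun n => truncated A n x) @ \oo --> hit A x)%classic.
Proof.
move=> /truncated_bounded [M MP].
apply: nondecreasing_is_cvgn => [m n|]; first exact: truncated_le.
by exists M => _ [n _ <-].
Qed.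

Lemma truncated_le_hit A n x : transient_off A -> truncated A n x <= hit A x.
Proof.
move=> TA; apply: nondecreasing_cvgn_le => [m k|]; first exact: truncated_le.
by apply/cvg_ex; exists (hit A x); exact: truncated_cvg.
Qed.

Lemma hit_ge0 A x : transient_off A -> 0 <= hit A x.
Proof.
by move=> TA; rewrite (le_trans _ (truncated_le_hit 0 x TA))// /truncated big_nil.
Qed.

Lemma hit_in A x : x \in A -> hit A x = 0.
Proof.
move=> xA; apply/cvg_lim => //; under eq_fun do rewrite truncated_in//.
exact: cvg_cst.
Qed.

Lemma hitE A x : transient_off A -> x \notin A -> hit A x = 1 + avg (hit A) x.
Proof.
move=> TA xA.
have C : ((fun n => truncated A n.+1 x) @ \oo --> hit A x)%classic.
  by rewrite (cvg_shiftS (fun n => truncated A n x)); exact: truncated_cvg.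
rewrite -(cvg_lim (@norm_hausdorff _ _) C); apply/cvg_lim => //.
under eq_fun do rewrite truncatedS//.
apply: cvgD; first exact: cvg_cst.
by apply: cvg_avg => y; exact: truncated_cvg.
Qed.

Lemma hit_le_super A (v : S -> R) x :
  (forall x, 0 <= v x) -> transient_off A ->
  (forall x, x \notin A -> 1 + avg v x <= v x) ->
  hit A x <= v x.
Proof.
move=> v0 TA sup.
have C : ((fun _ : nat => v x) @ \oo --> v x)%classic by exact: cvg_cst.
apply: (ler_cvg_to (@truncated_cvg A x TA) C).
by near=> n; exact: truncated_le_super.
Unshelve. all: by end_near. Qed.

Lemma survival_cvg0 A x : transient_off A ->
  ((fun n => survival A n x) @ \oo --> (0 : R))%classic.
Proof.
move=> TA; have -> : (fun n => survival A n x) =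
    (fun n => truncated A n.+1 x - truncated A n x).
  by apply/funext => n; rewrite /truncated big_nat_recr//= addrC addrK.
rewrite -(subrr (hit A x)); apply: cvgB; last exact: truncated_cvg.
by rewrite (cvg_shiftS (fun n => truncated A n x)); exact: truncated_cvg.
Qed.

Lemma sub_le_hit A (v : S -> R) M x : transient_off A ->
  (forall x, x \in A -> v x <= 0) ->
  (forall x, v x <= M) ->
  (forall x, x \notin A -> v x <= 1 + avg v x) ->
  v x <= hit A x.
Proof.
move=> TA vA vM sub.
have C : ((fun n => truncated A n.+1 x + M * survival A n x) @ \oo --> hit A x)%classic.
  rewrite -[hit A x]addr0 -(mulr0 M); apply: cvgD.
    by rewrite (cvg_shiftS (fun n => truncated A n x)); exact: truncated_cvg.
  by apply: cvgMl_tmp; exact: survival_cvg0.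
have C' : ((fun _ : nat => v x) @ \oo --> v x)%classic by exact: cvg_cst.
apply: (ler_cvg_to C' C).
by near=> n; exact: (sub_le_truncated _ _ vA).
Unshelve. all: by end_near. Qed.

End Kernel.

(** * Comparison of hitting times under the stationary distribution *)

Section Phases.
Context {R : realType} {S : finType}.
Variable p : S -> S -> R.
Hypothesis p_ge0 : forall x y, 0 <= p x y.
Hypothesis p_sum1 : forall x, \sum_y p x y = 1.
Implicit Types (A B : {set S}) (v w : S -> R) (x y : S).

Definition push (mu : S -> R) (y : S) : R := \sum_x mu x * p x y.

(** Acting on measures is dual to averaging functions. *)
Lemma push_avg (mu v : S -> R) :
  \sum_x mu x * avg p v x = \sum_y push mu y * v y.
Proof.
rewrite /push /avg; under eq_bigr do rewrite mulr_sumr.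
rewrite exchange_big; apply: eq_bigr => y _; rewrite mulr_suml.
by apply: eq_bigr => x _; rewrite mulrA.
Qed.

Lemma push_sum (mu : S -> R) : \sum_y push mu y = \sum_x mu x.
Proof.
rewrite -(eq_bigr _ (fun y _ => mulr1 (push mu y))) -(push_avg mu (fun=> 1)).
by apply: eq_bigr => x _; rewrite avg_cst// mulr1.
Qed.

Lemma push_le (mu nu : S -> R) y :
  (forall x, mu x <= nu x) -> push mu y <= push nu y.
Proof. by move=> le; apply: ler_sum => x _; rewrite ler_wpM2r. Qed.

Variable pi : S -> R.
Hypothesis pi_ge0 : forall x, 0 <= pi x.
Hypothesis pi_sum1 : \sum_x pi x = 1.
Hypothesis pi_inv : forall y, push pi y = pi y.

(** The measure mu records the stationary chain at those times when its last
    visit to the union of A and B was in A. It is the increasing limit of the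
    measures that look back over n steps only; comparison with pi bounds it. *)
Lemma exists_phase A B : [disjoint A & B] ->
  exists mu : S -> R,
    [/\ forall x, 0 <= mu x <= pi x,
        forall x, x \in A -> mu x = pi x,
        forall x, x \in B -> mu x = 0
      & forall x, x \notin A -> x \notin B -> mu x = push mu x].
Proof.
move=> dAB.
pose step (mu : S -> R) y :=
  if y \in A then pi y else if y \in B then 0 else push mu y.
pose m n := iter n step (fun=> 0).
have step_le mu nu y : (forall x, mu x <= nu x) -> step mu y <= step nu y.
  by rewrite /step => le; case: ifP => // _; case: ifP => // _; exact: push_le.
have m_le_pi n y : m n y <= pi y.
  elim: n y => [|n IH] y; first exact: pi_ge0.
  rewrite /m iterS -/(m n) /step; case: ifP => // _; case: ifP => // _.
  by rewrite -[leRHS]pi_inv; exact: push_le.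
have m_homo n y : m n y <= m n.+1 y.
  elim: n y => [|n IH] y; last first.
    by rewrite /m iterS -/(m n) iterS -/(m n.+1); exact: step_le.
  rewrite /m /= /step; case: ifP => // _; case: ifP => // _.
  by rewrite /push big1// => x _; rewrite mul0r.
have m_cvg y : cvgn (m ^~ y).
  apply: nondecreasing_is_cvgn; first exact/nondecreasing_seqP.
  by exists (pi y) => _ [n _ <-].
pose mu y := limn (m ^~ y).
have mu_cvg y : ((fun n => m n y) @ \oo --> mu y)%classic by exact: m_cvg.
have muE y : mu y = step mu y.
  have C : ((fun n => m n.+1 y) @ \oo --> mu y)%classic.
    by rewrite (cvg_shiftS (m ^~ y)).
  rewrite -(cvg_lim (@norm_hausdorff _ _) C); apply/cvg_lim => //.
  rewrite /step; under eq_fun do rewrite /m iterS -/(m _) /step.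
  case: ifP => _; first exact: cvg_cst.
  case: ifP => _; first exact: cvg_cst.
  rewrite /push; apply: cvg_big => [|x _]; first exact: add_continuous.
  by apply: cvgMr_tmp; exact: mu_cvg.
exists mu; split => [y|y yA|y yB|y yA yB].
- have homo : {homo m ^~ y : i j / (i <= j)%N >-> i <= j}.
    exact/nondecreasing_seqP.
  rewrite (nondecreasing_cvgn_le homo (@m_cvg y) 0)/=.
  have C : ((fun _ : nat => pi y) @ \oo --> pi y)%classic by exact: cvg_cst.
  by apply: (ler_cvg_to (@mu_cvg y) C); near=> n.
- by rewrite muE /step yA.
- by rewrite muE /step yB (disjointFl dAB yB).
- by rewrite [LHS]muE /step (negbTE yA) (negbTE yB).
Unshelve. all: by end_near. Qed.

(** The witness m is the stationary frequency of journeys from A to B, which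
    is also that of journeys from B to A. Let mu be the measure of
    [exists_phase] and d = mu - mu P. Then d is nonnegative on A, nonpositive
    on B and zero elsewhere, with mass m on A and - m on B. If g and h are the
    hitting times of B and A, summing g against d gives the total mass of mu,
    which is at least that of A and at most m T; summing h against - d gives
    the remaining mass, which is at least m c. *)
Lemma phase_comparison A B (g h : S -> R) (T c : R) :
  [disjoint A & B] -> 
  (forall x, x \in B -> g x = 0) ->
  (forall x, x \notin B -> g x = 1 + avg p g x) ->
  (forall x, g x <= T) ->
  (forall x, x \in A -> h x = 0) ->
  (forall x, x \notin A -> h x = 1 + avg p h x) ->
  (forall x, x \in B -> c <= h x) -> 
  exists2 m : R, \sum_(x in A) pi x <= m * T & m * c <= 1 - \sum_(x in A) pi x.
Proof.
move=> dAB gB gE gT hA hE hB.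
have [mu [mupi muA muB muE]] := exists_phase dAB.
pose d y := mu y - push mu y.
have dA y : y \in A -> 0 <= d y.
  move=> yA; rewrite /d muA// subr_ge0 -[leRHS]pi_inv; apply: push_le => x.
  by have /andP[] := mupi x.
have dB y : y \in B -> d y <= 0.
  move=> yB; rewrite /d muB// sub0r oppr_le0; apply: sumr_ge0 => x _.
  by have /andP[] := mupi x; move=> ? _; rewrite mulr_ge0.
have d0 y : y \notin A -> y \notin B -> d y = 0.
  by move=> yA yB; rewrite /d -muE// subrr.
have sum_d : \sum_y d y = 0 by rewrite sumrB push_sum subrr.
have sum_dg : \sum_y d y * g y = \sum_y mu y.
  rewrite (eq_bigr _ (fun y _ => mulrBl (g y) _ _)) sumrB -push_avg -sumrB.
  apply: eq_bigr => x _; rewrite -mulrBr.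
  have [xB|xB] := boolP (x \in B); first by rewrite muB// mul0r.
  by rewrite gE// addrK mulr1.
have sum_dh : \sum_y d y * h y = \sum_y mu y - 1.
  pose nu y := pi y - mu y.
  have -> : \sum_y d y * h y = \sum_y (push nu y - nu y) * h y.
    apply: eq_bigr => y _; congr (_ * _); rewrite /d /nu.
    suff -> : push nu y = pi y - push mu y by ring.
    by rewrite -pi_inv /push -sumrB; apply: eq_bigr => x _; rewrite /nu mulrBl.
  rewrite (eq_bigr _ (fun y _ => mulrBl (h y) _ _)) sumrB -push_avg -sumrB.
  rewrite -pi_sum1 -sumrB.
  apply: eq_bigr => x _; rewrite -mulrBr.
  have [xA|xA] := boolP (x \in A); first by rewrite /nu muA// subrr mul0r.
  by rewrite [h x]hE// /nu; ring.
have mu_A : \sum_(x in A) pi x <= \sum_x mu x.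
  rewrite big_mkcond; apply: ler_sum => x _; case: ifP => [/muA ->//|_].
  by have /andP[] := mupi x.
pose m := \sum_(y in A) d y.
have mE : m = \sum_y - (if y \in B then d y else 0).
  have -> : m = \sum_y (d y - (if y \in B then d y else 0)).
    rewrite /m big_mkcond; apply: eq_bigr => y _; have [yA|yA] := boolP (y \in A).
      by rewrite (disjointFr dAB yA) subr0.
    by case: ifPn => yB; rewrite ?subrr// d0// subr0.
  by rewrite sumrB sum_d sub0r sumrN.
exists m.
  rewrite (le_trans mu_A)// -sum_dg /m mulr_suml [leRHS]big_mkcond/=.
  apply: ler_sum => y _.
  have [yA|yA] := boolP (y \in A); first by rewrite ler_wpM2l ?dA.
  have [yB|yB] := boolP (y \in B); first by rewrite gB// mulr0.
  by rewrite d0// mul0r.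
apply: (@le_trans _ _ (1 - \sum_y mu y)); last by rewrite lerD2l lerN2.
rewrite -(opprB _ 1) -sum_dh mE mulr_suml -sumrN; apply: ler_sum => y _.
have [yB|yB] := boolP (y \in B).
  by rewrite mulNr lerN2 ler_wnM2l ?dB ?hB.
rewrite oppr0 mul0r; have [yA|yA] := boolP (y \in A).
  by rewrite hA// mulr0 oppr0.
by rewrite d0// mul0r oppr0.
Qed.

Hypothesis reach : forall y, transient_off p [set y]%SET.

Lemma reach_set A : A != finset.set0 -> transient_off p A.
Proof.
case/finset.set0Pn => y yA; apply: (transient_off_subset p_ge0 _ (reach y)).
by rewrite finset.sub1set.
Qed.

(** Let c be slightly more than (1/a - 1) T. The set B where the hitting time
    of A exceeds c cannot have mass 1/2 or more, by [phase_comparison]. So its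
    complement is hit within mean time T, and the hitting time of A minus c,
    which is at most 0 there, is at most the hitting time of that complement. *)
Lemma hit_le_half A (T a : R) x :
  0 < a -> a <= 2^-1 -> a <= \sum_(y in A) pi y ->
  (forall B x, 2^-1 <= \sum_(y in B) pi y -> hit p B x <= T) ->
  hit p A x <= T / a.
Proof.
move=> a0 a2 aA HT.
have neq0 (B : {set S}) : 0 < \sum_(y in B) pi y -> transient_off p B.
  by move=> B0; apply: reach_set; apply: contraTneq B0 => ->; rewrite big_set0 ltxx.
have TA : transient_off p A by apply/neq0/(lt_le_trans a0).
have T0 : 0 <= T.
  apply: le_trans (HT [set: S]%SET x _); last first.
    by rewrite (eq_bigl xpredT) => [|y]; rewrite ?inE// pi_sum1; lra.
  by rewrite hit_in ?inE.
apply/ler_addgt0Pr => e e0.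
(* The slack e turns the comparison of A with B into a strict inequality. *)
pose c := (a^-1 - 1) * T + e.
have c0 : 0 <= c.
  rewrite /c addr_ge0 ?mulr_ge0//; last exact: ltW.
  by rewrite subr_ge0 invf_ge1//; lra.
pose B := [set x | c < hit p A x]%SET.
have dAB : [disjoint A & B].
  apply/pred0P => y /=; apply/negP => /andP[yA]; rewrite inE hit_in//.
  by rewrite ltNge c0.
have B2 : \sum_(y in B) pi y < 2^-1.
  rewrite ltNge; apply/negP => B2.
  have TB : transient_off p B by apply/neq0/(lt_le_trans _ B2); lra.
  have [] := @phase_comparison A B (hit p B) (hit p A) T c dAB.
  - by move=> y; exact: hit_in.
  - by move=> y; exact: hitE.
  - by move=> y; exact: HT.
  - by move=> y; exact: hit_in.
  - by move=> y; exact: hitE.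
  - by move=> y; rewrite inE => /ltW.
  move=> m H1 H2.
  have amT : a <= m * T by exact: le_trans H1.
  have mc : m * c <= 1 - a by apply: le_trans H2 _; lra.
  have m0 : 0 < m by rewrite ltNge; apply/negP => m0; have := mulr_le0_ge0 m0 T0; lra.
  have : (a^-1 - 1) * a <= (a^-1 - 1) * (m * T).
    by rewrite ler_wpM2l// subr_ge0 invf_ge1//; lra.
  rewrite mulrBl mulVf ?gt_eqF// mul1r.
  have := mulr_gt0 m0 e0; move: mc; rewrite /c; lra.
pose C := finset.setC B.
have C2 : 2^-1 <= \sum_(y in C) pi y.
  have : \sum_(y in B) pi y + \sum_(y in C) pi y = 1.
    rewrite -pi_sum1 [RHS](bigID (mem B))/=; congr (_ + _).
    by apply: eq_bigl => y; rewrite inE.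
  lra.
have TC : transient_off p C by apply/neq0/(lt_le_trans _ C2); lra.
have [M MP] := truncated_bounded p_ge0 p_sum1 TA.
have hM y : hit p A y <= M.
  have C' : ((fun _ : nat => M) @ \oo --> M)%classic by exact: cvg_cst.
  apply: (ler_cvg_to (@truncated_cvg _ _ _ p_ge0 p_sum1 A y TA) C').
  by near=> n; exact: MP.
have : hit p A x - c <= hit p C x.
  apply: (@sub_le_hit _ _ p p_ge0 p_sum1 C (fun y => hit p A y - c) (M - c) x TC).
  - by move=> y; rewrite !inE -leNgt subr_le0.
  - by move=> y; rewrite lerD2r.
  - move=> y yC; rewrite avgD avg_cst// addrA lerD2r -hitE//.
    by move: yC; rewrite !inE negbK; apply: contraL => yA; rewrite hit_in// -leNgt.
have := HT C x C2; rewrite /c; lra.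
Unshelve. all: by end_near. Qed.

End Phases.

(** * From the law of the chain to the transition matrix *)

Section ChainLaw.
Context {R : realType} (C : markov_chain R).
Local Notation p := (trans C).
Local Open Scope classical_set_scope.

Lemma proc_in_measurable s (A : {set state C}) :
  measurable [set w | proc C s w \in A].
Proof.
have -> : [set w | proc C s w \in A] =
    \bigcup_(a in [set a | a \in A]) [set w | proc C s w = a].
  apply/seteqP; split => w /=; first by move=> wA; exists (proc C s w).
  by case=> a /= aA ->.
apply: fin_bigcup_measurable => [|a _]; first exact: finite_finset.
exact: proc_measurable.
Qed.

Lemma path_in_measurable (A : nat -> {set state C}) n :
  measurable [set w | forall s, (s <= n)%N -> proc C s w \in A s].
Proof.
have -> : [set w | forall s, (s <= n)%N -> proc C s w \in A s] =
    \bigcap_(s in [set s | (s <= n)%N]) [set w | proc C s w \in A s].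
  by apply/seteqP; split.
apply: bigcap_measurable; first by exists 0%N.
move=> s _; exact: proc_in_measurable.
Qed.

Lemma avoid_measurable (A : {set state C}) n :
  measurable [set w | forall s, (s <= n)%N -> proc C s w \notin A].
Proof.
have := path_in_measurable (fun=> ~: A)%SET n.
set E := mkset _; set F := mkset _; suff -> : E = F by [].
by apply/seteqP; split => w /= H s sn; have := H s sn; rewrite inE.
Qed.

Lemma law_split x s (E : set (sample C)) : measurable E ->
  law C x E = (\sum_z law C x (E `&` [set w | proc C s w = z]))%E.
Proof.
move=> mE; pose F z := E `&` [set w | proc C s w = z].
have {1}-> : E = \bigcup_(z in [set: state C]) F z.
  by apply/seteqP; split => [w Ew|w [z _ []//]]; exists (proc C s w).
rewrite measure_fin_bigcup//.
- rewrite (fsbigE (index_enum (state C))) ?index_enum_uniq//.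
    by apply: eq_bigl => z; rewrite in_setT.
  by move=> z _; rewrite mem_index_enum.
- exact: finite_finset.
- apply/trivIsetP => i j _ _ ij; apply/seteqP; split=> // w [[_ /= wi] [_ /= wj]].
  by move: ij; rewrite -wi -wj eqxx.
- by move=> z _; apply: measurableI => //; exact: proc_measurable.
Qed.



(** The Markov property extends only completely specified trajectories, so the
    induction on m carries a specified beginning of arbitrary length t and
    splits on the state at time t + 1. *)
Lemma law_path_stays (D : nat -> {set state C}) m t (y : nat -> state C) x :
  law C x ([set w | forall s, (s <= t)%N -> proc C s w = y s] `&`
           [set w | forall s, (s <= m)%N -> proc C (t + s) w \in D s]) =
  (law C x [set w | forall s, (s <= t)%N -> proc C s w = y s] *
    (stays p D m (y t))%:E)%E.
Proof.
have mpath t' (y' : nat -> state C) :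
    measurable [set w | forall s, (s <= t')%N -> proc C s w = y' s].
  have := path_in_measurable (fun s => [set y' s]%SET) t'.
  set E := mkset _; set F := mkset _; suff -> : E = F by [].
  by apply/seteqP; split => w /= H s st; [apply/set1P|apply/set1P]; exact: H.
have mtail t' m' (D' : nat -> {set state C}) :
    measurable [set w | forall s, (s <= m')%N -> proc C (t' + s) w \in D' s].
  have -> : [set w | forall s, (s <= m')%N -> proc C (t' + s) w \in D' s] =
      \bigcap_(s in [set s | (s <= m')%N]) [set w | proc C (t' + s) w \in D' s].
    by apply/seteqP; split.
  apply: bigcap_measurable; first by exists 0%N.
  by move=> s _; exact: proc_in_measurable.
elim: m D t y => [|m IH] D t y.
  rewrite /= mulr1; have [yD|yD] := boolP (y t \in D 0%N).
    rewrite mule1; congr (law C x _); apply/seteqP; split => [w []//|w /= H].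
    by split=> // s; rewrite leqn0 => /eqP ->; rewrite addn0 H.
  rewrite mule0; rewrite (_ : _ `&` _ = set0) ?measure0//.
  apply/seteqP; split => // w [/= H /(_ 0%N isT)].
  by rewrite addn0 H// (negbTE yD).
rewrite [stays _ _ _ _]/=; have [yD|yD] := boolP (y t \in D 0%N); last first.
  rewrite mul0r mule0; rewrite (_ : _ `&` _ = set0) ?measure0//.
  apply/seteqP; split => // w [/= H /(_ 0%N isT)].
  by rewrite addn0 H// (negbTE yD).
rewrite mul1r (law_split x t.+1); last exact: measurableI.
pose yz z s := if (s <= t)%N then y s else z.
have yzt z : yz z t = y t by rewrite /yz leqnn.
have yzS z : yz z t.+1 = z by rewrite /yz ltnn.
have ev z : [set w | forall s, (s <= t.+1)%N -> proc C s w = yz z s] =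
    [set w | forall s, (s <= t)%N -> proc C s w = y s] `&` [set w | proc C t.+1 w = z].
  apply/seteqP; split => w /=.
    move=> H; split; last by rewrite H// yzS.
    by move=> s st; rewrite H ?(leq_trans st)// /yz st.
  move=> [H1 H2] s; rewrite leq_eqVlt => /orP[/eqP -> |]; first by rewrite yzS.
  by rewrite ltnS => st; rewrite H1// /yz st.
have ev0 z : [set w | forall s, (s <= t)%N -> proc C s w = yz z s] =
    [set w | forall s, (s <= t)%N -> proc C s w = y s].
  by apply/seteqP; split => w /= H s st; rewrite H// /yz st.
transitivity (\sum_z
  (law C x [set w | forall s, (s <= t)%N -> proc C s w = y s] *
   (p (y t) z * stays p (fun i => D i.+1) m z)%:E))%E.
  apply: eq_bigr => z _.
  rewrite EFinM muleA -[X in (_ * (p X _)%:E)%E](yzt z) -[X in (_ * (p _ X)%:E)%E](yzS z).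
  rewrite -[X in (law C x X * _)%E](ev0 z) -proc_markov -[X in stays _ _ _ X](yzS z) -IH ev.
  congr (law C x _); apply/seteqP; split => w /=.
    move=> [[H1 H2] H3]; split=> // s sm; rewrite addSnnS; exact: H2.
  move=> [[H1 H2] H3]; split=> //; split=> // -[|s] sm; first by rewrite addn0 H1.
  by rewrite -addSnnS; exact: H3.
rewrite -ge0_sume_distrr//; first by rewrite sumEFin.
move=> z _; rewrite lee_fin mulr_ge0 ?trans_ge0//.
elim: (m) (fun i => D i.+1) z => [|k IHk] D' z /=; first by rewrite mulr1 ler0n.
rewrite mulr_ge0 ?ler0n// sumr_ge0// => u _.
by rewrite mulr_ge0 ?trans_ge0.
Qed.

(** The initial state is x only almost surely, hence the detour through the
    trajectories that start at x. *)
Lemma law_stays (D : nat -> {set state C}) m x :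
  law C x [set w | forall s, (s <= m)%N -> proc C s w \in D s] =
  (stays p D m x)%:E.
Proof.
have m0 : measurable [set w | proc C 0 w = x] by exact: proc_measurable.
have mE := path_in_measurable D m.
have E0 : [set w | forall s, (s <= 0)%N -> proc C s w = x] = [set w | proc C 0 w = x].
  apply/seteqP; split => w /= H; first exact: H.
  by move=> s; rewrite leqn0 => /eqP ->.
have := law_path_stays D m 0 (fun=> x) x.
rewrite E0 proc_start mul1e => <-.
have {1}-> := law_split x 0 mE.
rewrite (bigD1 x)//= big1 ?adde0; last first.
  move=> z zx; apply/eqP; rewrite -measure_le0.
  apply: (@le_trans _ _ (law C x (~` [set w | proc C 0 w = x]))).
    apply: le_measure; rewrite ?inE.
    - by apply: measurableI => //; exact: proc_measurable.
    - exact: measurableC.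
    - by move=> w [_ /= ->]; exact/eqP.
  by rewrite probability_setC// proc_start subee.
by rewrite setIC.
Qed.

Lemma law_survival (A : {set state C}) n x :
  law C x [set w | forall s, (s <= n)%N -> proc C s w \notin A] =
  (survival p A n x)%:E.
Proof.
rewrite -law_stays; congr (law C x _); apply/seteqP.
by split => w /= H s sn; have := H s sn; rewrite inE.
Qed.

(** A hitting time is the number of instants that precede it, also when it is
    infinite. *)
Lemma hitting_time_series (A : {set state C}) (w : sample C) :
  hitting_time A w =
  (\sum_(0 <= n <oo) (\1_[set w | forall s, (s <= n)%N -> proc C s w \notin A] w)%:E)%E.
Proof.
rewrite /hitting_time.
have [[t0 tA]|noA] := pselect (exists t, proc C t w \in A).
  have ex : exists t, proc C t w \in A by exists t0.
  case: (ex_minnP ex) => n nA nmin.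
  transitivity ((n%:R : R)%:E).
    apply/eqP; rewrite eq_le; apply/andP; split.
      by apply: ereal_inf_lbound; exists n.
    apply: le_ereal_inf_tmp => _ [t /= tA' <-].
    by rewrite lee_fin ler_nat; exact: nmin.
  rewrite (nneseries_split 0%N n) => [|k _]; last by rewrite lee_fin.
  rewrite add0n eseries0 ?adde0.
    rewrite sumEFin big_mkord (eq_bigr (fun=> 1)).
      by rewrite sumr_const card_ord.
    move=> i _; rewrite indicE mem_set//= => s si.
    apply/negP => sA; have := nmin s sA.
    by rewrite leqNgt (leq_ltn_trans si).
  move=> k nk _; rewrite indicE memNset//= => /(_ n nk).
  by rewrite nA.
have -> : [set (t%:R : R)%:E | t in [set t : nat | proc C t w \in A]] = set0.
  by apply/seteqP; split => // _ [t /= tA _]; apply: noA; exists t.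
rewrite ereal_inf0; apply/esym/eq_infty => r.
have ones n : \1_[set w | forall s, (s <= n)%N -> proc C s w \notin A] w = 1 :> R.
  rewrite indicE mem_set//= => s _; apply/negP => sA.
  by apply: noA; exists s.
pose N := (Num.truncn r).+1.
apply: (@le_trans _ _ (N%:R)%:E).
  by rewrite lee_fin ltW// truncnS_gt.
apply: le_trans (nneseries_lim_ge N _); last by move=> k _ _; rewrite lee_fin.
rewrite sumEFin big_mkord (eq_bigr (fun=> 1)) => [|i _]; last exact: ones.
by rewrite sumr_const card_ord.
Qed.

Lemma expected_hitting_timeE (A : {set state C}) x :
  expected_hitting_time x A = (\sum_(0 <= n <oo) (survival p A n x)%:E)%E.
Proof.
rewrite /expected_hitting_time; under eq_integral do rewrite hitting_time_series.
have mE := avoid_measurable A.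
rewrite integral_nneseries//.
- apply: eq_eseriesr => n _; rewrite integral_indic//.
  by rewrite setIT; exact: law_survival.
- by move=> n; exact/measurable_EFinP/measurable_indic.
Qed.

Lemma expected_hitting_time_fin (A : {set state C}) x :
  transient_off p A -> expected_hitting_time x A = (hit p A x)%:E.
Proof.
move=> TA; rewrite expected_hitting_timeE; apply/cvg_lim => //.
rewrite (_ : (fun n => _) = (fun n => (truncated p A n x)%:E)); last first.
  by apply/funext => n; rewrite /truncated sumEFin.
apply: cvg_EFin; first by near=> n.
exact: (truncated_cvg (@trans_ge0 _ C) (@trans_sum1 _ C)).
Unshelve. all: by end_near. Qed.

End ChainLaw.

(** * Maximal hitting times and the upper bound on profiles *)

Section Irreducibility.
Context {R : realType} (C : markov_chain R).
Local Open Scope classical_set_scope.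

Lemma irreducible_transient_off :
  irreducible C -> forall y, transient_off (trans C) [set y]%SET.
Proof.
move=> irr y x; have [t xty] := irr x y; exists t.
rewrite -lte_fin -law_survival.
have mX : measurable [set w | proc C t w = y] by exact: proc_measurable.
apply: (@le_lt_trans _ _ (law C x (~` [set w | proc C t w = y]))).
  apply: le_measure; rewrite ?inE; last first.
  - by move=> w /= /(_ t (leqnn t)) /set1P.
  - exact: measurableC.
  - exact: avoid_measurable.
rewrite probability_setC//; move: xty.
have := probability_le1 (law C x) mX.
case: (law C x _) => [r| |]//; rewrite lee_fin lte_fin => _ r0.
by rewrite -EFinB lte_fin ltrBlDr ltrDl.
Qed.

(** If y were almost surely never visited from x, then so would be the union
    of countably many null events, and survival off y would have probability
    1. *)
Lemma transient_off_irreducible :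
  (forall y, transient_off (trans C) [set y]%SET) -> irreducible C.
Proof.
move=> H x y; apply: contrapT => /forallNP no.
have [t] := H y x; suff -> : survival (trans C) [set y]%SET t x = 1 by rewrite ltxx.
have mX s : measurable [set w | proc C s w = y] by exact: proc_measurable.
have X0 s : law C x [set w | proc C s w = y] = 0%E.
  by apply/eqP; rewrite -measure_le0 leNgt; apply/negP; exact: no.
apply: EFin_inj; rewrite -law_survival.
have mU : measurable (\bigcup_s [set w | proc C s w = y]).
  by apply: bigcup_measurable => s _; exact: mX.
have U0 : law C x (\bigcup_s [set w | proc C s w = y]) = 0%E.
  apply/(negligibleP (law C x) mU)/negligible_bigcup => s.
  by apply/(negligibleP (law C x) (mX s)); exact: X0.
have U1 : law C x (~` \bigcup_s [set w | proc C s w = y]) = 1%E.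
  by rewrite probability_setC// U0 sube0.
apply/eqP; rewrite eq_le; apply/andP; split.
  by apply: probability_le1; exact: avoid_measurable.
rewrite -[leLHS]U1; apply: le_measure; rewrite ?inE.
- exact: measurableC.
- exact: avoid_measurable.
- by move=> w /= nU s _; apply/set1P => ws; apply: nU; exists s.
Qed.

End Irreducibility.

Section MaxHittingTime.
Context {R : realType} (C : markov_chain R) (pi : state C -> R).
Hypothesis reach : forall y, transient_off (trans C) [set y]%SET.
Hypothesis stat : stationary pi.
Local Notation hit := (hit (trans C)).

Lemma stationary_push y : push (trans C) pi y = pi y.
Proof. by case: stat => _ _; exact. Qed.

Lemma transient_off_mass (a : R) (A : {set state C}) :
  0 < a -> a <= \sum_(y in A) pi y -> transient_off (trans C) A.
Proof.
move=> a0 aA; apply: (reach_set (@trans_ge0 _ C) reach).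
by apply: contraTneq aA => ->; rewrite big_set0 -ltNge.
Qed.

Lemma max_hitting_time_le (a M : R) : 0 < a ->
  (forall x (A : {set state C}), a <= \sum_(y in A) pi y -> hit A x <= M) ->
  (max_hitting_time pi a <= M%:E)%E.
Proof.
move=> a0 HM; apply: bigmax_le => [|x _]; first exact: leNye.
apply: bigmax_le => [|A aA]; first exact: leNye.
by rewrite expected_hitting_time_fin ?lee_fin ?HM//; exact: transient_off_mass aA.
Qed.

Lemma max_hitting_time_ge (a : R) x (A : {set state C}) :
  0 < a -> a <= \sum_(y in A) pi y -> ((hit A x)%:E <= max_hitting_time pi a)%E.
Proof.
move=> a0 aA; rewrite -expected_hitting_time_fin; last exact: transient_off_mass aA.
apply: (bigmax_sup x) => //.
exact: (@le_bigmax_cond _ _ _ _ A (fun A : {set state C} => a <= \sum_(y in A) pi y)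
  (fun A => expected_hitting_time x A)).
Qed.

Lemma max_hitting_time_fin (a : R) : 0 < a -> a <= 1 ->
  max_hitting_time pi a \is a fin_num.
Proof.
move=> a0 a1; case: stat => pi0 pi1 _.
have [x _] : exists x : state C, true.
  apply/existsP; rewrite -[X in is_true X]negbK; apply/negP => /existsPn nx.
  move: pi1; rewrite big1 => [/eqP|x _]; first by rewrite eq_sym oner_eq0.
  by have := nx x.
have bnd (A : {set state C}) :
    exists M, forall y, a <= \sum_(y in A) pi y -> hit A y <= M.
  exists (\sum_y `|hit A y|) => y _; rewrite (bigD1 y)//=.
  by rewrite (le_trans (ler_norm _))// lerDl sumr_ge0.
have [M MP] := choice bnd.
rewrite fin_numElt; apply/andP; split.
  have aT : a <= \sum_(y in [set: state C]%SET) pi y.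
    by rewrite (eq_bigl xpredT) => [|y]; rewrite ?inE// pi1.
  by apply: lt_le_trans (max_hitting_time_ge x a0 aT); exact: ltNyr.
apply: (@le_lt_trans _ _ (\sum_A `|M A|)%:E); last exact: ltry.
apply: max_hitting_time_le => // y A aA; rewrite (le_trans (MP _ _ aA))//.
by rewrite (bigD1 A)//= (le_trans (ler_norm _))// lerDl sumr_ge0.
Qed.

Lemma hit_le_max_hitting_time (a : R) x (A : {set state C}) :
  0 < a -> a <= 1 -> a <= \sum_(y in A) pi y ->
  hit A x <= fine (max_hitting_time pi a).
Proof.
by move=> a0 a1 aA; rewrite -lee_fin fineK ?max_hitting_time_fin// max_hitting_time_ge.
Qed.

Lemma fine_max_hitting_time_le (a M : R) : 0 < a -> a <= 1 ->
  (forall x (A : {set state C}), a <= \sum_(y in A) pi y -> hit A x <= M) ->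
  fine (max_hitting_time pi a) <= M.
Proof.
by move=> a0 a1 HM; rewrite -lee_fin fineK ?max_hitting_time_fin// max_hitting_time_le.
Qed.

(** One of two distinct states has mass at most 1/2; from it, its complement
    is not hit at time 0. *)
Lemma max_hitting_time_half_ge1 : (1 < #|state C|)%N ->
  1 <= fine (max_hitting_time pi 2^-1).
Proof.
case: stat => pi0 pi1 _ /card_gt1P[u [v [_ _ uv]]].
have [x x2] : exists x, pi x <= 2^-1.
  have : pi u + pi v <= 1.
    rewrite -pi1 (bigD1 u)//= (bigD1 v)//= 1?eq_sym// addrA lerDl.
    by rewrite sumr_ge0.
  have [?|?] := leP (pi u) 2^-1; first by exists u.
  by exists v; lra.
pose A := finset.setC [set x]%SET.
have A2 : 2^-1 <= \sum_(y in A) pi y.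
  have : pi x + \sum_(y in A) pi y = 1.
    rewrite -pi1 [RHS](bigD1 x)//=; congr (_ + _).
    by apply: eq_bigl => y; rewrite !inE.
  lra.
have h0 : 0 < 2^-1 :> R by rewrite invr_gt0.
have TA := transient_off_mass h0 A2.
apply: le_trans (hit_le_max_hitting_time x h0 _ A2); last by lra.
rewrite (hitE (@trans_ge0 _ C) (@trans_sum1 _ C) TA); last by rewrite !inE eqxx.
rewrite lerDl avg_ge0 ?trans_ge0// => y; first exact: trans_ge0.
exact: (hit_ge0 (@trans_ge0 _ C) (@trans_sum1 _ C)).
Qed.

Lemma max_hitting_time_le_half (a : R) : 0 < a -> a <= 2^-1 ->
  fine (max_hitting_time pi a) <= fine (max_hitting_time pi 2^-1) / a.
Proof.
move=> a0 a2; case: (stat) => pi0 pi1 _.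
apply: fine_max_hitting_time_le => //; first by lra.
move=> x A aA.
apply: (hit_le_half (@trans_ge0 _ C) (@trans_sum1 _ C) pi0 pi1 stationary_push reach) => //.
by move=> B y B2; apply: hit_le_max_hitting_time => //; lra.
Qed.

End MaxHittingTime.

Section Necessity.
Context {R : realType}.
Implicit Types f g : R -> R.

Lemma hitting_profile_bounds g : hitting_profile g ->
  g 2^-1 = 1 /\ forall a, 0 < a -> a <= 2^-1 -> g a <= a^-1.
Proof.
move=> [_ [C [pi [C1 irr st gE]]]].
have reach := irreducible_transient_off irr.
have T1 := max_hitting_time_half_ge1 reach st C1.
have T0 : 0 < fine (max_hitting_time pi 2^-1) by lra.
split; first by rewrite gE ?invr_gt0// divff// gt_eqF.
move=> a a0 a2; rewrite gE// ler_pdivrMr// mulrC.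
exact: max_hitting_time_le_half.
Qed.

(** If f a > 1/a, then f b >= f a > 1/b for every b in the nonempty interval
    from 1/(f a) to a, so convergence would fail on that whole interval. *)
Lemma closure_bounds f : hitting_profile_closure f ->
  f 2^-1 = 1 /\ forall a, 0 < a -> a < 2^-1 -> f a <= 1 / a.
Proof.
move=> [df [g [gP gf gh]]]; split.
  have C : ((fun n => g n 2^-1) @ \oo --> (1 : R))%classic.
    rewrite (_ : (fun n => g n 2^-1) = fun=> 1); first exact: cvg_cst.
    by apply/funext => n; case: (hitting_profile_bounds (gP n)).
  by rewrite -(cvg_lim (@norm_hausdorff _ _) gh) (cvg_lim (@norm_hausdorff _ _) C).
move=> a a0 a2; rewrite div1r leNgt; apply/negP => afa.
have fa0 : 0 < f a by apply: lt_trans afa; rewrite invr_gt0.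
have fia : (f a)^-1 < a by rewrite -[ltRHS]invrK ltf_pV2 ?posrE ?invr_gt0.
have bad b : (f a)^-1 < b < a -> ~ ((fun n => g n b) @ \oo --> f b)%classic.
  move=> /andP[b1 b2] C.
  have b0 : 0 < b by apply: lt_trans b1; rewrite invr_gt0.
  have C' : ((fun _ : nat => b^-1) @ \oo --> b^-1)%classic by exact: cvg_cst.
  have : f b <= b^-1.
    apply: (ler_cvg_to C C'); near=> n.
    by case: (hitting_profile_bounds (gP n)) => _; apply => //; lra.
  have : f a <= f b by apply: df => //; lra.
  have : b^-1 < f a by rewrite -[ltRHS]invrK ltf_pV2 ?posrE ?invr_gt0.
  lra.
have [N [mN N0 subN]] := gf.
pose I := (`](f a)^-1, a[%classic : set R).
have : ((@lebesgue_measure R) I <= (@lebesgue_measure R) N)%E.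
  apply: le_measure; [by rewrite inE; exact: measurable_itv|by rewrite inE|].
  move=> b; rewrite /I /= in_itv/= => /andP[b1 b2]; apply: subN => /= H.
  have b0 : 0 < b by apply: lt_trans b1; rewrite invr_gt0.
  by apply: (bad b); [rewrite b1 b2|apply: H; lra].
rewrite [leRHS]N0 /I lebesgue_measure_itv/= lte_fin fia -EFinB lee_fin; lra.
Unshelve. all: by end_near. Qed.

End Necessity.

(** * Realising a stochastic matrix by an expanding map of the line *)

Section UnitLaw.
Context {R : realType}.
Local Open Scope classical_set_scope.

(** The chain started at the state numbered x has the uniform law on the x-th
    unit interval: all the laws live on one sample space with common
    trajectories. *)
Definition unit_law (x : R) : set (measurableTypeR R) -> \bar R :=
  mrestr (@lebesgue_measure R) (measurable_itv `[x, x + 1[%R).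

HB.instance Definition _ x := Measure.on (unit_law x).

Lemma unit_law_setT x : unit_law x setT = 1%E.
Proof.
rewrite /unit_law /mrestr setTI lebesgue_measure_itv/= lte_fin ltrDl ltr01.
by rewrite -EFinD addrAC subrr add0r.
Qed.

HB.instance Definition _ x :=
  Measure_isProbability.Build _ _ _ (unit_law x) (unit_law_setT x).

End UnitLaw.

Section Locate.
Context {R : realType} (n : nat).
Implicit Types (a l : 'I_n.+1 -> R) (x y z : 'I_n.+1).

Definition cell a l y (u : R) := a y <= u < a y + l y.

(** The index y whose interval from a y to a y + l y contains u; it is 0 if
    there is none. *)
Definition locate a l (u : R) : 'I_n.+1 := odflt ord0 [pick y | cell a l y u].

Definition ordered_cells a l :=
  forall y z, (y < z)%N -> a y + l y <= a z.

Lemma locate_cell a l y u : ordered_cells a l -> cell a l y u -> locate a l u = y.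
Proof.
move=> ord yu; rewrite /locate; case: pickP => [z zu /=|/(_ y)]; last by rewrite yu.
move: yu zu => /andP[y1 y2] /andP[z1 z2].
apply/eqP; rewrite -[_ == _]/(_ == _ :> nat) eqn_leq leqNgt [X in _ && X]leqNgt.
by apply/andP; split; apply/negP => /ord; lra.
Qed.

Lemma locate_measurable a l y : ordered_cells a l ->
  measurable [set u : measurableTypeR R | locate a l u = y]%classic.
Proof.
move=> ord.
have mc z : measurable [set u : measurableTypeR R | cell a l z u]%classic.
  have := measurable_itv (R := R) `[a z, a z + l z[.
  by congr measurable; apply/seteqP; split => u /=; rewrite in_itv.
have -> : [set u : measurableTypeR R | locate a l u = y]%classic =
  ([set u | cell a l y u] `|`
   ([set u | ord0 = y] `&` \bigcap_z ~` [set u | cell a l z u]))%classic.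
  apply/seteqP; split => u /=.
    rewrite /locate; case: pickP => [z zu /= <-|no /= <-]; [by left|right].
    by split => // z _ /=; rewrite no.
  move=> [/(locate_cell ord) //|[<- no]].
  by rewrite /locate; case: pickP => // z zu; have := no z I; rewrite /= zu.
apply: measurableU => //; apply: measurableI.
  have [<-|ny] := pselect (ord0 = y).
    by rewrite (_ : mkset _ = setT)//; apply/seteqP; split.
  by rewrite (_ : mkset _ = set0)//; apply/seteqP; split.
apply: fin_bigcap_measurable => [|z _]; first exact: finite_finset.
exact: measurableC.
Qed.

End Locate.

Section Realisation.
Context {R : realType} (n : nat).
Variable p : 'I_n.+1 -> 'I_n.+1 -> R.
Hypothesis p_ge0 : forall x y, 0 <= p x y.
Hypothesis p_sum1 : forall x, \sum_y p x y = 1.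
Implicit Types x y z : 'I_n.+1.

Definition cum x y : R := \sum_(z : 'I_n.+1 | (z < y)%N) p x z.

(** The interval of [0, 1[ allotted to a transition from x to y has length p x
    y and is stretched onto [0, 1[. A uniform position therefore stays uniform
    given the transition, which is the Markov property. *)
Definition turn (s : 'I_n.+1 * R) : 'I_n.+1 * R :=
  let y := locate (cum s.1) (p s.1) s.2 in (y, (s.2 - cum s.1 y) / p s.1 y).

(** The integer part is the initial state, the fractional part the position
    that drives the transitions. *)
Definition launch (w : R) : 'I_n.+1 * R :=
  let x := locate (fun x => x%:R) (fun=> 1) w in (x, w - x%:R).

Definition path_of (t : nat) (w : measurableTypeR R) : 'I_n.+1 :=
  (iter t turn (launch w)).1.

Lemma cum_ge0 x y : 0 <= cum x y.
Proof. exact: sumr_ge0. Qed.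

Lemma cum_le x y z : (y < z)%N -> cum x y + p x y <= cum x z.
Proof.
move=> yz; rewrite /cum [leRHS](bigD1 y)//= addrC lerD2r.
rewrite [leLHS]big_mkcond [leRHS]big_mkcond; apply: ler_sum => i _ /=.
case: ifP => [iy|_]; last by case: ifP.
by rewrite (ltn_trans iy yz) -(inj_eq val_inj) /= neq_ltn iy.
Qed.

Lemma cum_le1 x y : cum x y + p x y <= 1.
Proof.
rewrite -(p_sum1 x) (bigD1 y)//= addrC lerD2r.
rewrite /cum [leLHS]big_mkcond [leRHS]big_mkcond; apply: ler_sum => i _ /=.
case: ifP => [iy|_]; last by case: ifP.
by rewrite -(inj_eq val_inj) /= neq_ltn iy.
Qed.

Lemma cell_cover x u : 0 <= u -> u < 1 -> exists y, cell (cum x) (p x) y u.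
Proof.
move=> u0; rewrite -(p_sum1 x) => u1.
have key m : (m <= n.+1)%N -> u < \sum_(z : 'I_n.+1 | (z < m)%N) p x z ->
    exists y, cell (cum x) (p x) y u.
  elim: m => [|m IH] mn um; first by move: um; rewrite big1 ?ltNge ?u0.
  have [um'|um'] := ltP u (\sum_(z : 'I_n.+1 | (z < m)%N) p x z).
    by apply: IH => //; exact: ltnW.
  exists (Ordinal mn); rewrite /cell /cum um'/=; apply: lt_le_trans um _.
  rewrite (bigD1 (Ordinal mn))//= addrC lerD2r.
  rewrite [leLHS]big_mkcond [leRHS]big_mkcond; apply: ler_sum => i _ /=.
  case: ifP => [/andP[im]|_]; last by case: ifP.
  by rewrite -(inj_eq val_inj) /= => ni; rewrite ltn_neqAle ni -ltnS im.
apply: (key n.+1) => //; rewrite (lt_le_trans u1)// [leRHS]big_mkcond.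
by apply: ler_sum => i _; rewrite ltn_ord.
Qed.

Lemma locate_next x y u : 0 <= u -> u < 1 ->
  (locate (cum x) (p x) u == y) = cell (cum x) (p x) y u.
Proof.
move=> u0 u1; apply/eqP/idP; last exact/locate_cell/cum_le.
have [z zu] := cell_cover x u0 u1.
by rewrite (locate_cell (@cum_le x) zu) => <-.
Qed.

Lemma iter_turn_measurable t x y :
  measurable [set u : measurableTypeR R | (iter t turn (x, u)).1 = y]%classic.
Proof.
elim: t x => [|t IH] x.
  have [->|xy] := eqVneq x y.
    by rewrite (_ : mkset _ = setT)//; apply/seteqP; split.
  by rewrite (_ : mkset _ = set0)//; apply/seteqP; split => // u /= /eqP;
    rewrite (negbTE xy).
pose g z (u : measurableTypeR R) : measurableTypeR R := (u - cum x z) / p x z.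
pose F (u : measurableTypeR R) := (iter t.+1 turn (x, u)).1.
have FE u : F u = (iter t turn (turn (x, u))).1 by rewrite /F iterSr.
rewrite (_ : mkset _ = [set u | F u = y]%classic)//.
have -> : [set u : measurableTypeR R | F u = y]%classic =
  (\bigcup_z ([set u | locate (cum x) (p x) u = z] `&`
     (setT `&` g z @^-1` [set v | (iter t turn (z, v)).1 = y])))%classic.
  apply/seteqP; split => u /=.
    by rewrite FE => H; exists (locate (cum x) (p x) u).
  by case=> z _ [/= zu [_]]; rewrite FE /g /turn /= zu.
apply: fin_bigcup_measurable => [|z _]; first exact: finite_finset.
apply: measurableI; first by apply: locate_measurable; exact: cum_le.
have mg : measurable_fun setT (g z).
  apply: measurable_funM; last exact: measurable_cst.
  by apply: measurable_funB; [exact: measurable_id|exact: measurable_cst].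
by apply: mg => //; exact: IH.
Qed.

Lemma path_of_measurable t y : measurable [set w | path_of t w = y]%classic.
Proof.
pose g z (w : measurableTypeR R) : measurableTypeR R := w - z%:R.
have -> : [set w | path_of t w = y]%classic =
  (\bigcup_z ([set w : measurableTypeR R |
                 locate (fun x : 'I_n.+1 => x%:R) (fun=> 1) w = z] `&`
     (setT `&` g z @^-1` [set v | (iter t turn (z, v)).1 = y])))%classic.
  apply/seteqP; split => w; rewrite /= /path_of.
    by move=> H; exists (locate (fun x : 'I_n.+1 => x%:R) (fun=> 1) w).
  by case=> z _ [/= zw [_]]; rewrite /g /launch /= zw.
apply: fin_bigcup_measurable => [|z _]; first exact: finite_finset.
apply: measurableI.
  by apply: locate_measurable => i j ij; rewrite natr1 ler_nat.
have mg : measurable_fun setT (g z).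
  by apply: measurable_funB; [exact: measurable_id|exact: measurable_cst].
by apply: mg => //; exact: iter_turn_measurable.
Qed.

(** Pulling an interval back through one stretched piece multiplies its length
    by the probability of that transition. *)
Lemma cylinder_itv t (y : nat -> 'I_n.+1) : exists a : R,
  [set u : R | 0 <= u < 1 /\
    forall s, (s <= t)%N -> (iter s turn (y 0%N, u)).1 = y s]%classic
  = [set u | a <= u < a + \prod_(s < t) p (y s) (y s.+1)]%classic.
Proof.
elim: t y => [|t IH] y.
  exists 0; rewrite big_ord0 add0r; apply/seteqP; split => u /=.
    by case.
  by move=> u01; split => // s; rewrite leqn0 => /eqP ->.
have [a E] := IH (fun s => y s.+1).
set L := \prod_(s < t) _ in E; set c := cum (y 0%N) (y 1%N); set q := p (y 0%N) (y 1%N).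
have q0 : 0 <= q by exact: p_ge0.
have c0 : 0 <= c by exact: cum_ge0.
have cq1 : c + q <= 1 by exact: cum_le1.
exists (c + q * a).
have -> : \prod_(s < t.+1) p (y s) (y s.+1) = q * L by rewrite big_ord_recl.
have tailE u v : (locate (cum (y 0%N)) (p (y 0%N)) u = y 1%N) -> v = (u - c) / q ->
  forall s, iter s.+1 turn (y 0%N, u) = iter s turn (y 1%N, v).
  by move=> lu -> s; rewrite iterSr /turn/= lu.
have E' v :
    (0 <= v < 1 /\ forall s, (s <= t)%N -> (iter s turn (y 1%N, v)).1 = y s.+1) <->
    a <= v < a + L.
  have := congr1 (fun A : set R => A v) E; rewrite /= => ->; split=> //.
apply/seteqP; split => u /=.
  move=> [/andP[u0 u1] H].
  have /eqP := H 1%N isT; rewrite /= locate_next// => cu.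
  have := cu; rewrite /cell -/c -/q => /andP[cu1 cu2].
  have qp : 0 < q by lra.
  have lu := locate_cell (@cum_le (y 0%N)) cu.
  have [+ _] := E' ((u - c) / q).
  have -> : 0 <= (u - c) / q < 1.
    by rewrite divr_ge0 ?subr_ge0//= ltr_pdivrMr// mul1r; lra.
  have tl : forall s, (s <= t)%N -> (iter s turn (y 1%N, (u - c) / q)).1 = y s.+1.
    by move=> s st; rewrite -(tailE u)// H.
  move=> /(_ (conj isT tl)); rewrite ler_pdivlMr// ltr_pdivrMr// => /andP[? ?].
  by apply/andP; split; lra.
(* A transition of probability 0 is allotted an empty interval. *)
have [qz|qnz] := eqVneq q 0; first by rewrite qz !mul0r; lra.
have qp : 0 < q by rewrite lt0r qnz.
move=> /andP[h1 h2].
have [_] := E' ((u - c) / q).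
rewrite ler_pdivlMr// ltr_pdivrMr//.
have -> : (a * q <= u - c < (a + L) * q) by apply/andP; split; lra.
move=> /(_ isT) [/andP[]]; rewrite ler_pdivlMr// ltr_pdivrMr// => v0 v1 H.
have lu : locate (cum (y 0%N)) (p (y 0%N)) u = y 1%N.
  apply: (locate_cell (@cum_le (y 0%N))); rewrite /cell -/c -/q; lra.
split; first by lra.
by move=> [|s] // st; rewrite (tailE u _ lu erefl) H.
Qed.

Lemma law_path_of x t (y : nat -> 'I_n.+1) :
  unit_law (x%:R : R) [set w | forall s, (s <= t)%N -> path_of s w = y s]%classic =
  ((y 0%N == x)%:R * \prod_(s < t) p (y s) (y s.+1))%:E.
Proof.
have launchE (w : R) : x%:R <= w < x%:R + 1 -> launch w = (x, w - x%:R).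
  move=> wx; rewrite /launch (@locate_cell _ _ _ _ x)// => i j ij.
  by rewrite natr1 ler_nat.
rewrite /unit_law /mrestr; have [yx|yx] := eqVneq (y 0%N) x; last first.
  rewrite mul0r (_ : _ `&` _ = set0)%classic ?measure0//.
  apply/seteqP; split => // w [/= H]; rewrite ?in_itv/= => wx.
  have : (launch w).1 = y 0%N := H 0%N isT; rewrite launchE//= => xy.
  by rewrite -xy eqxx in yx.
subst x; rewrite mul1r; have [a E] := cylinder_itv t y.
set L := \prod_(s < t) _ in E *.
rewrite (_ : _ `&` _ = ([set` `[(y 0%N)%:R + a, (y 0%N)%:R + a + L[%R] : set R))%classic.
  rewrite lebesgue_measure_itv/= lte_fin ltrDl.
  have : 0 <= L by apply: prodr_ge0 => s _; exact: p_ge0.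
  rewrite le0r => /orP[/eqP ->|L0]; first by rewrite ltxx.
  by rewrite L0 -EFinD; congr EFin; ring.
have E' v :
    (0 <= v < 1 /\ forall s, (s <= t)%N -> (iter s turn (y 0%N, v)).1 = y s) <->
    a <= v < a + L.
  have := congr1 (fun A : set R => A v) E; rewrite /= ?in_itv/= => ->; split=> //.
apply/seteqP; split => w /=; rewrite ?in_itv/=.
  move=> [H wx]; have [E1 _] := E' (w - (y 0%N)%:R).
  have /E1 /andP[? ?] : 0 <= w - (y 0%N)%:R < 1 /\
      forall s, (s <= t)%N -> (iter s turn (y 0%N, w - (y 0%N)%:R)).1 = y s.
    split; first by lra.
    by move=> s st; rewrite -(H s st) /path_of launchE//.
  by apply/andP; split; lra.
move=> wa; have [_ E2] := E' (w - (y 0%N)%:R).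
have /E2 [] : a <= w - (y 0%N)%:R < a + L by lra.
move=> wx H; have wx' : (y 0%N)%:R <= w < (y 0%N)%:R + 1 by lra.
by split => // s st; rewrite /path_of launchE// H.
Qed.

Lemma path_of_start x : unit_law (x%:R : R) [set w | path_of 0 w = x]%classic = 1%E.
Proof.
have := law_path_of x 0 (fun=> x); rewrite eqxx big_ord0 mulr1 => <-.
congr unit_law; apply/seteqP; split => w /= H; last exact: H.
by move=> s; rewrite leqn0 => /eqP ->.
Qed.

Lemma path_of_markov x t (y : nat -> 'I_n.+1) :
  unit_law (x%:R : R) [set w | forall s, (s <= t.+1)%N -> path_of s w = y s]%classic =
  (unit_law (x%:R : R) [set w | forall s, (s <= t)%N -> path_of s w = y s]%classic
     * (p (y t) (y t.+1))%:E)%E.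
Proof. by rewrite !law_path_of big_ord_recr /= mulrA EFinM. Qed.

Definition realisation : markov_chain R :=
  @MarkovChain R 'I_n.+1 p p_ge0 p_sum1 _ (measurableTypeR R)
    (fun x => unit_law x%:R) path_of path_of_measurable path_of_start path_of_markov.

End Realisation.

(** * Chains with prescribed masses and hitting times *)

Section PathChain.
Context {R : realType} (k : nat) (al phi : nat -> R).
Hypothesis k_gt0 : (0 < k)%N.
Hypothesis al0 : al 0%N = 1.
Hypothesis al_end : al k.+1 = 0.
Hypothesis al_decr : forall i, (i <= k)%N -> al i.+1 < al i.
Hypothesis al_half : al 1%N < 2^-1.
Hypothesis phi0 : phi 0%N = 1.
Hypothesis phi_incr : forall i, (i < k)%N -> phi i < phi i.+1.
Hypothesis phi_al_le1 : forall i, (i <= k)%N -> phi i * al i <= 1.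
Hypothesis phi_al_end : phi k * al k = 1.
Implicit Types (x y : 'I_k.+1) (S : {set 'I_k.+1}) (V : nat -> R).

(** Here al i is the total mass of the states from i on. *)
Definition mass (i : nat) : R := al i - al i.+1.
(** The stationary flow from i to i - 1. It makes phi i - 1 the mean time from
    0 to i, as [target_below] verifies. For i = 0 the quotient is 0 / 0, which
    has the wanted value 0. *)
Definition back (i : nat) : R := (1 - phi i * al i) / (phi i - phi i.-1).
(** The stationary flow from i - 1 to i: what crosses downwards between these
    states is the flow back to i - 1 and the resets, at rate 1, of the mass al
    i. *)
Definition fwd (i : nat) : R := al i + back i.

Definition up (i : nat) : R := if (i < k)%N then fwd i.+1 / mass i else 0.
Definition down (i : nat) : R := back i / mass i.
Definition reset (i : nat) : R := (0 < i)%N%:R.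

(** The duration of one step. Any positive value would do that keeps the
    probability of leaving a state at most 1. *)
Definition eta : R := (1 + \sum_(i < k.+1) (up i + down i + reset i))^-1.

Definition step x y : R :=
  eta * up x * (y == x.+1 :> nat)%:R + eta * down x * (y == x.-1 :> nat)%:R +
  eta * reset x * (y == 0%N :> nat)%:R +
  (1 - eta * (up x + down x + reset x)) * (y == x :> nat)%:R.

Lemma al_lt i j : (i < j)%N -> (j <= k.+1)%N -> al j < al i.
Proof.
elim: j => // j IH; rewrite ltnS leq_eqVlt => /orP[/eqP -> jk|ij jk].
  exact: al_decr.
by apply: lt_trans (IH ij _); [exact: al_decr|exact: ltnW].
Qed.

Lemma al_le i j : (i <= j)%N -> (j <= k.+1)%N -> al j <= al i.
Proof. by rewrite leq_eqVlt => /orP[/eqP -> //|ij jk]; exact/ltW/al_lt. Qed.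

Lemma phi_lt i j : (i < j)%N -> (j <= k)%N -> phi i < phi j.
Proof.
elim: j => // j IH; rewrite ltnS leq_eqVlt => /orP[/eqP -> jk|ij jk].
  exact: phi_incr.
by apply: (lt_trans (IH ij _)); [exact: ltnW|exact: phi_incr].
Qed.

Lemma phi_le i j : (i <= j)%N -> (j <= k)%N -> phi i <= phi j.
Proof. by rewrite leq_eqVlt => /orP[/eqP -> //|ij jk]; exact/ltW/phi_lt. Qed.

Lemma phi_ge1 i : (i <= k)%N -> 1 <= phi i.
Proof. by move=> ik; rewrite -phi0 phi_le. Qed.

Lemma mass_gt0 i : (i <= k)%N -> 0 < mass i.
Proof. by move=> ik; rewrite subr_gt0 al_decr. Qed.

Lemma back_ge0 i : (i <= k)%N -> 0 <= back i.
Proof.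
move=> ik; rewrite divr_ge0 ?subr_ge0 ?phi_al_le1//.
by apply: phi_le => //; exact: leq_pred.
Qed.

Lemma fwd_ge0 i : (i <= k)%N -> 0 <= fwd i.
Proof.
by move=> ik; rewrite addr_ge0 ?back_ge0// -al_end al_le// ltnW.
Qed.

Lemma back_flow i : (i <= k)%N -> back i * (phi i - phi i.-1) = 1 - phi i * al i.
Proof.
case: i => [|i] ik; first by rewrite al0 phi0 subrr mulr0 mul1r subrr.
by rewrite /back mulfVK// gt_eqF// subr_gt0 phi_incr.
Qed.

Lemma up_ge0 i : (i <= k)%N -> 0 <= up i.
Proof.
move=> ik; rewrite /up; case: ifP => // ik'.
by rewrite divr_ge0 ?fwd_ge0// ltW// mass_gt0.
Qed.

Lemma down_ge0 i : (i <= k)%N -> 0 <= down i.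
Proof. by move=> ik; rewrite divr_ge0 ?back_ge0// ltW// mass_gt0. Qed.

Lemma reset_ge0 i : 0 <= reset i. Proof. exact: ler0n. Qed.

Let rates_ge0 (i : 'I_k.+1) : 0 <= up i + down i + reset i.
Proof. by rewrite !addr_ge0 ?up_ge0 ?down_ge0 ?reset_ge0// -ltnS. Qed.

Lemma eta_gt0 : 0 < eta.
Proof. by rewrite invr_gt0 ltr_wpDr ?sumr_ge0. Qed.

Lemma eta_rates x : eta * (up x + down x + reset x) <= 1.
Proof.
rewrite mulrC ler_pdivrMr ?mul1r; last by rewrite ltr_wpDr ?sumr_ge0.
by rewrite (bigD1 x)//= addrCA lerDl addr_ge0 ?sumr_ge0.
Qed.

Lemma step_ge0 x y : 0 <= step x y.
Proof.
have xk : (x <= k)%N by rewrite -ltnS.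
have e0 := ltW eta_gt0; have u0 := up_ge0 xk; have d0 := down_ge0 xk.
have r1 : 0 <= 1 - eta * (up x + down x + reset x) by rewrite subr_ge0 eta_rates.
apply: addr_ge0; last by rewrite mulr_ge0 ?ler0n.
rewrite !addr_ge0//; apply: mulr_ge0; rewrite ?ler0n//.
all: by apply: mulr_ge0; rewrite ?reset_ge0.
Qed.

Lemma sum_dirac V (m : nat) : (m <= k)%N ->
  \sum_(y < k.+1) (y == m :> nat)%:R * V y = V m.
Proof.
rewrite -ltnS => mk; rewrite (bigD1 (Ordinal mk))//= eqxx mul1r big1 ?addr0// => y.
by rewrite -(inj_eq val_inj) /= => /negbTE ->; rewrite mul0r.
Qed.

Lemma avg_step V x :
  avg step (fun y => V y) x = V x + eta * (up x * (V x.+1 - V x) +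
     down x * (V x.-1 - V x) + reset x * (V 0%N - V x)).
Proof.
have xk : (x <= k)%N by rewrite -ltnS.
have -> : avg step (fun y => V y) x = eta * up x * V x.+1 +
   eta * down x * V x.-1 + eta * reset x * V 0%N +
   (1 - eta * (up x + down x + reset x)) * V x; last by ring.
pose d (m : nat) y : R := (y == m :> nat)%:R * V y.
transitivity (\sum_y (eta * up x * d x.+1 y + eta * down x * d x.-1 y +
    eta * reset x * d 0%N y + (1 - eta * (up x + down x + reset x)) * d x y)).
  by apply: eq_bigr => y _; rewrite /step /d; ring.
rewrite !big_split /= -!mulr_sumr (sum_dirac V xk) (sum_dirac V (leq0n k)).
rewrite (sum_dirac V (leq_trans (leq_pred _) xk)).
congr (_ + _ + _ + _); have [xk'|xk'] := ltnP x k; first by rewrite sum_dirac.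
by rewrite /up ltnNge xk' /= mulr0 !mul0r.
Qed.

Lemma step_sum1 x : \sum_y step x y = 1.
Proof.
transitivity (avg step (fun=> 1) x); first by apply: eq_bigr => y _; rewrite mulr1.
by rewrite (avg_step (fun=> 1)) subrr; ring.
Qed.

(** Summation by parts: below state m the flow balance telescopes to the flow
    back out of m and the reset flow al m, and nothing lies above state k. *)
Lemma mass_avg V :
  \sum_(x < k.+1) mass x * avg step (fun y => V y) x = \sum_(x < k.+1) mass x * V x.
Proof.
pose T' i := fwd i.+1 * (V i.+1 - V i) - back i * (V i - V i.-1)
  - mass i * (V i - V 0%N).
have part m : (m <= k)%N -> \sum_(i < m) T' i =
    back m * (V m - V m.-1) + al m * (V m - V 0%N).
  elim: m => [|m IH] mk; first by rewrite big_ord0; ring.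
  by rewrite big_ord_recr/= IH 1?ltnW// /T' /fwd /mass /=; ring.
apply/eqP; rewrite -subr_eq0 -sumrB.
have massK i : (i <= k)%N -> mass i != 0 by move=> /mass_gt0/lt0r_neq0.
have -> : \sum_(x < k.+1) (mass x * avg step (fun y => V y) x - mass x * V x) =
    eta * (\sum_(i < k) T' i + (- back k * (V k - V k.-1) - mass k * (V k - V 0%N))).
  rewrite big_ord_recr/= [RHS]mulrDr [X in _ = X + _]mulr_sumr; congr (_ + _).
    apply: eq_bigr => i _.
    have := avg_step V (widen_ord (leqnSn k) i); rewrite /= => ->.
    have ik := ltn_ord i; have mi := massK i (ltnW ik).
    rewrite /up ik /T' /down /reset.
    move: mi; have [->|i0] := posnP i => mi /=; field; exact: mi.
  have := avg_step V ord_max; rewrite /= => ->.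
  have mk := massK k (leqnn k).
  rewrite /up ltnn /down /reset.
  by move: mk; have [->|k0] := posnP k => mk /=; field; exact: mk.
by rewrite part// /mass al_end; apply/eqP; ring.
Qed.

Definition path_chain : markov_chain R := realisation step_ge0 step_sum1.

Lemma mass_telescope i j : (i <= j)%N ->
  \sum_(i <= m < j) mass m = al i - al j.
Proof.
move=> ij; rewrite -opprB -telescope_sumr//= -sumrN.
by apply: eq_bigr => m _; rewrite opprB.
Qed.

Lemma path_stationary : @stationary R path_chain (fun x : 'I_k.+1 => mass x).
Proof.
split.
- by move=> x; apply/ltW/mass_gt0; rewrite -ltnS.
- by rewrite -(big_mkord xpredT) mass_telescope// al0 al_end subr0.
- move=> y; rewrite -[RHS](_ : \sum_(x < k.+1) mass x * (x == y :> nat)%:R = _); last first.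
    by under eq_bigr do rewrite mulrC; rewrite sum_dirac// -ltnS.
  rewrite -(mass_avg (fun i => (i == y)%:R)); apply: eq_bigr => x _; congr (_ * _).
  rewrite /avg (bigD1 y)//= eqxx mulr1 big1 ?addr0// => z zy.
  by rewrite -[_ == _ :> nat]/(z == y) (negbTE zy) mulr0.
Qed.

(** The candidate for the mean time to reach S when i is its least element.
    Below i only i itself matters, and the time is phi i - phi j. A state
    above i and outside S is given the time phi i of a full return to 0
    followed by the journey from 0 to i, although S may be met earlier. *)
Definition target i S (j : nat) : R :=
  (if (j < i)%N then phi i - phi j else if inord j \in S then 0 else phi i) / eta.

Section Target.
Variables (S : {set 'I_k.+1}) (i : nat).
Hypothesis ik : (i <= k)%N.
Hypothesis iS : inord i \in S.

Lemma target_ge0 j : 0 <= target i S j.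
Proof.
have p1 := phi_ge1 ik.
rewrite /target divr_ge0 ?(ltW eta_gt0)//; case: ltnP => ji.
  by rewrite subr_ge0 phi_le// ltnW.
by case: ifP => // _; lra.
Qed.

Lemma target_le j : (j <= k)%N -> target i S j <= phi i / eta.
Proof.
move=> jk; have pi1 := phi_ge1 ik; have pj1 := phi_ge1 jk.
have e1 : 0 < eta^-1 by rewrite invr_gt0; exact: eta_gt0.
rewrite /target ler_pM2r//; case: ltnP => ji; first by lra.
by case: ifP => // _; lra.
Qed.

Lemma target_0 : target i S 0 = (phi i - 1) / eta.
Proof.
rewrite /target; case: ltnP => i0; first by rewrite phi0.
by move: iS i0; rewrite leqn0 => + /eqP i0; rewrite i0 => ->; rewrite phi0 subrr.
Qed.

(** Multiplied by the mass of x, the equation compares the flow across the two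
    edges at x: by [back_flow] they contribute 1 - al (x+1) phi x and 1 - al x
    phi x, and their difference is the mass of x times phi x. *)
Lemma target_below x : (x < i)%N ->
  target i S x = 1 + avg step (fun y => target i S y) x.
Proof.
move=> xi; rewrite (avg_step (target i S)) target_0.
have xk : (x < k)%N by exact: leq_trans ik.
have e0 : eta != 0 by rewrite gt_eqF ?eta_gt0.
have m0 : mass x != 0 by rewrite gt_eqF// mass_gt0// ltnW.
have -> : target i S x = (phi i - phi x) / eta by rewrite /target xi.
have -> : target i S x.-1 = (phi i - phi x.-1) / eta.
  by rewrite /target (leq_ltn_trans (leq_pred _) xi).
have -> : target i S x.+1 = (phi i - phi x.+1) / eta.
  rewrite /target; case: ltnP => // ix.
  have -> : x.+1 = i by apply/eqP; rewrite eqn_leq ix xi.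
  by rewrite iS subrr.
have rphi : reset x * (phi x - 1) = phi x - 1.
  by rewrite /reset; case: (val x) => [|j]; rewrite ?phi0 ?subrr ?mulr0// mul1r.
have H1 := back_flow (ltnW xk); have H2 := back_flow xk.
have H : up x * (phi x - phi x.+1) + down x * (phi x - phi x.-1) + (phi x - 1) = - 1.
  have um : mass x * up x = fwd x.+1 by rewrite /up xk mulrC divfK.
  have dm : mass x * down x = back x by rewrite mulrC divfK.
  apply: (mulfI m0).
  have -> : mass x * (up x * (phi x - phi x.+1) +
      down x * (phi x - phi x.-1) + (phi x - 1)) =
    mass x * up x * (phi x - phi x.+1) + mass x * down x * (phi x - phi x.-1)
     + mass x * (phi x - 1) by ring.
  by rewrite um dm /fwd /mass; move: H1 H2; rewrite /=; lra.
have -> : eta * (up x * ((phi i - phi x.+1) / eta - (phi i - phi x) / eta) +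
    down x * ((phi i - phi x.-1) / eta - (phi i - phi x) / eta) +
    reset x * ((phi i - 1) / eta - (phi i - phi x) / eta)) =
  up x * (phi x - phi x.+1) + down x * (phi x - phi x.-1) + reset x * (phi x - 1).
  by field.
by rewrite rphi H; ring.
Qed.

(** Above i, moves to neighbours do not increase [target], and the reset at
    rate 1 decreases it by exactly one unit of time. *)
Lemma target_super x : x \notin S ->
  1 + avg step (fun y => target i S y) x <= target i S x.
Proof.
move=> xS; have [xi|ix] := ltnP x i; first by rewrite -target_below.
have xk : (x <= k)%N by rewrite -ltnS.
have e0 := eta_gt0.
have tx : target i S x = phi i / eta by rewrite /target ltnNge ix /= inord_val (negbTE xS).
have x0 : (0 < x)%N.
  rewrite lt0n; apply/eqP => x0; move: ix xS; rewrite x0 leqn0 => /eqP i0.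
  by rewrite -(inord_val x) x0 -i0 iS.
rewrite (avg_step (target i S)) target_0 tx.
have H1 : up x * (target i S x.+1 - phi i / eta) <= 0.
  rewrite /up; case: ifP => [xk'|_]; last by rewrite mul0r.
  have := up_ge0 xk; rewrite /up xk' => u0.
  by rewrite mulr_ge0_le0 ?subr_le0 ?target_le.
have H2 : down x * (target i S x.-1 - phi i / eta) <= 0.
  rewrite mulr_ge0_le0 ?down_ge0 ?subr_le0 ?target_le//.
  exact: leq_trans (leq_pred _) xk.
have H3 : eta * (reset x * ((phi i - 1) / eta - phi i / eta)) = - 1.
  by rewrite /reset x0 /=; field; rewrite gt_eqF.
rewrite mulrDr H3.
have := mulr_ge0_le0 (ltW e0) (ler_wnDr H2 H1); lra.
Qed.

Lemma path_hit_le x : transient_off step S -> hit step S x <= phi i / eta.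
Proof.
move=> TS; apply: le_trans (target_le (j := x) _); last by rewrite -ltnS.
apply: (hit_le_super step_ge0 step_sum1 (v := fun y : 'I_k.+1 => target i S y)) => //.
- by move=> y; exact: target_ge0.
- exact: target_super.
Qed.

Lemma path_transient : transient_off step S.
Proof.
apply: bounded_transient_off => x; exists (target i S x) => n.
apply: (truncated_le_super step_ge0 (v := fun y : 'I_k.+1 => target i S y)).
- by move=> y; exact: target_ge0.
- exact: target_super.
Qed.

End Target.

(** The states from i on except the last one, which is kept out to serve as
    the slowest starting point. *)
Definition block (i : nat) : {set 'I_k.+1} := [set x : 'I_k.+1 | (i <= x < k)%N]%SET.

Lemma block_mass i : (i < k)%N -> \sum_(y in block i) mass y = al i - al k.
Proof.
move=> ik; rewrite -mass_telescope ?(ltnW ik)//.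
rewrite (big_nat_widenl _ 0)// (big_nat_widen _ _ k.+1)// big_mkord.
by apply: eq_bigl => y; rewrite inE.
Qed.

(** Since phi k al k = 1 there is no flow back from k, so from k the only move
    is the reset and [target] is exact there as well. *)
Lemma path_hit_ge i : (i < k)%N -> phi i / eta <= hit step (block i) ord_max.
Proof.
move=> ik; have ik' := ltnW ik.
have iS : inord i \in block i by rewrite inE inordK ?leqnn// ltnS.
have TS := path_transient ik' iS.
have kS : inord k \notin block i.
  by rewrite inE inordK// ltnn andbF.
have tk : target i (block i) k = phi i / eta.
  by rewrite /target ltnNge ik' /= (negbTE kS).
rewrite -tk; apply: (sub_le_hit step_ge0 step_sum1 ord_max TS
  (v := fun y : 'I_k.+1 => target i (block i) y)
  (M := phi i / eta)) => //.
- move=> x xS; rewrite /target inord_val xS; move: xS; rewrite inE => /andP[ix _].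
  by rewrite ltnNge ix /= mul0r.
- by move=> x; apply: target_le => //; rewrite -ltnS.
- move=> x; rewrite inE negb_and -ltnNge -leqNgt => /orP[xi|kx].
    by rewrite -target_below.
  have xk : x = ord_max by apply/val_inj/eqP; rewrite /= eqn_leq kx -ltnS ltn_ord.
  rewrite (avg_step (target i (block i))) xk /= target_0// tk.
  have -> : up k = 0 by rewrite /up ltnn.
  have -> : down k = 0 by rewrite /down /back phi_al_end subrr !mul0r.
  have -> : reset k = 1 by rewrite /reset; case: (k) ik.
  have e0 := eta_gt0.
  rewrite !mul0r !add0r mul1r.
  suff -> : eta * ((phi i - 1) / eta - phi i / eta) = - 1 by lra.
  by field; rewrite gt_eqF.
Qed.

Lemma set_mass_le S i : (forall y, y \in S -> (i <= y)%N) -> (i <= k)%N ->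
  \sum_(y in S) mass y <= al i.
Proof.
have -> : al i = al i - al k.+1 by rewrite al_end subr0.
move=> iS ik; rewrite -mass_telescope; last by rewrite ltnW.
rewrite (big_nat_widenl _ 0)// big_mkord [leLHS]big_mkcond [leRHS]big_mkcond.
apply: ler_sum => y _ /=; have m0 : 0 <= mass y by apply/ltW/mass_gt0; rewrite -ltnS.
by case: ifP => [/iS -> //|_]; case: ifP.
Qed.

Lemma path_reach y : transient_off step [set y]%SET.
Proof.
by apply: (@path_transient _ y); [rewrite -ltnS|rewrite inord_val inE].
Qed.

Lemma path_hit_le_level S x (a M : R) : 0 < a -> a <= \sum_(y in S) mass y ->
  (forall i, (i <= k)%N -> a <= al i -> phi i <= M) ->
  hit step S x <= M / eta.
Proof.
move=> a0 aS aM.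
have [y0 y0S] : exists y, y \in S.
  by apply/finset.set0Pn; apply: contraTneq aS => ->; rewrite big_set0 -ltNge.
have [i iS imin] := arg_minnP (fun y : 'I_k.+1 => y : nat) y0S.
have ik : (i <= k)%N by rewrite -ltnS.
have iS' : inord i \in S by rewrite inord_val.
apply: le_trans (path_hit_le ik iS' x (path_transient ik iS')) _.
rewrite ler_pM2r; last by rewrite invr_gt0; exact: eta_gt0.
by apply: aM => //; rewrite (le_trans aS)// set_mass_le.
Qed.

Local Notation T a :=
  (fine (@max_hitting_time R path_chain (fun x : 'I_k.+1 => mass x) a)).

Let T_le := @fine_max_hitting_time_le R path_chain (fun x : 'I_k.+1 => mass x)
  path_reach path_stationary.
Let le_T := @hit_le_max_hitting_time R path_chain (fun x : 'I_k.+1 => mass x)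
  path_reach path_stationary.

Let half_gt0 : 0 < 2^-1 :> R. Proof. by rewrite invr_gt0. Qed.
Let half_le1 : 2^-1 <= 1 :> R. Proof. by rewrite invf_le1 ?ler1n. Qed.

Lemma path_time_le (a M : R) : 0 < a -> a <= 2^-1 ->
  (forall i, (i <= k)%N -> a <= al i -> phi i <= M) -> T a <= M / eta.
Proof.
move=> a0 a2 aM; apply: T_le => //.
  exact: le_trans half_le1.
by move=> x A aA; exact: path_hit_le_level aM.
Qed.

Lemma path_time_ge (a : R) i : 0 < a -> a <= 2^-1 -> (i < k)%N ->
  a <= al i - al k -> phi i / eta <= T a.
Proof.
move=> a0 a2 ik aik; apply: le_trans (path_hit_ge ik) _.
apply: le_T => //.
  exact: le_trans half_le1.
by rewrite -(block_mass ik) in aik.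
Qed.

Lemma path_time_half : T 2^-1 = eta^-1.
Proof.
have a1 i : (0 < i)%N -> (i <= k)%N -> al i < 2^-1.
  by move=> i0 ik; apply: le_lt_trans al_half; apply: al_le => //; exact: leqW.
apply/eqP; rewrite eq_le; apply/andP; split.
  rewrite -[leRHS]mul1r; apply: path_time_le => // -[|i] ik; first by rewrite phi0.
  by rewrite leNgt a1.
have -> : eta^-1 = phi 0%N / eta by rewrite phi0 mul1r.
apply: path_time_ge => //.
by rewrite al0; have := a1 k k_gt0 (leqnn k); lra.
Qed.

Lemma path_profile : exists g : R -> R, [/\ hitting_profile g,
  forall a M, 0 < a -> a <= 2^-1 ->
    (forall i, (i <= k)%N -> a <= al i -> phi i <= M) -> g a <= M
  & forall a i, 0 < a -> a <= 2^-1 -> (i < k)%N -> a <= al i - al k ->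
    phi i <= g a].
Proof.
exists (fun a => T a / T 2^-1); rewrite path_time_half invrK.
have e0 := eta_gt0.
split.
- split.
    move=> a b a0 ab b2; rewrite ler_pM2r//.
    have b0 : 0 < b by exact: lt_le_trans ab.
    apply: T_le => //.
      exact: le_trans half_le1.
    move=> x A bA; apply: le_T => //.
      by rewrite (le_trans ab)// (le_trans b2).
    exact: le_trans bA.
  exists path_chain, (fun x : 'I_k.+1 => mass x); split.
  + by rewrite card_ord.
  + exact: (@transient_off_irreducible R path_chain path_reach).
  + exact: path_stationary.
  + by move=> a a0 a2; rewrite path_time_half invrK.
- by move=> a M a0 a2 aM; rewrite -ler_pdivlMr//; exact: path_time_le.
- by move=> a i a0 a2 ik aik; rewrite -ler_pdivrMr//; exact: path_time_ge.
Qed.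

End PathChain.

(** * Approximating a bounded decreasing function by profiles *)

Section Sufficiency.
Context {R : realType} (f : R -> R).
Hypothesis f_decr : decreasing_half f.
Hypothesis f_half : f 2^-1 = 1.
Hypothesis f_le : forall a, 0 < a -> a < 2^-1 -> f a <= a^-1.

Section Level.
Variable n : nat.
Let k := n.+2.
Definition mesh : R := k.+1%:R^-1.
(** The values at 0, ..., k + 1 are 1, then the multiples of mesh / 2 from k
    down to 0. *)
Definition alpha (i : nat) : R := if i is 0%N then 1 else (k.+1 - i)%:R * (mesh / 2).
(** The share of 1/alpha makes the levels strictly increase even where f is
    constant, as the definition of the flows back requires. *)
Definition level (i : nat) : R :=
  if i is 0%N then 1 else
  if (i < k)%N then (1 - mesh) * f (alpha i) + mesh * (alpha i)^-1 else (alpha i)^-1.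

Lemma mesh_gt0 : 0 < mesh. Proof. by rewrite invr_gt0 ltr0n. Qed.

Lemma mesh_lt1 : mesh < 1. Proof. by rewrite invf_lt1 ?ltr0n// ltr1n. Qed.

Lemma mesh_mul : k.+1%:R * mesh = 1. Proof. by rewrite mulfV. Qed.

Lemma alphaE i : (0 < i)%N -> (i <= k.+1)%N -> alpha i = 2^-1 - i%:R * (mesh / 2).
Proof.
case: i => // i _ ik; rewrite /alpha natrB// mulrBl.
by have := mesh_mul; lra.
Qed.

Lemma alpha_gt0 i : (i <= k)%N -> 0 < alpha i.
Proof.
case: i => [|i] ik; first exact: ltr01.
by rewrite mulr_gt0// ?ltr0n ?subn_gt0// divr_gt0 ?mesh_gt0.
Qed.

Lemma alpha_lt_half i : (0 < i)%N -> (i <= k.+1)%N -> alpha i < 2^-1.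
Proof.
move=> i0 ik; rewrite alphaE// ltrBlDr ltrDl.
by rewrite mulr_gt0 ?ltr0n// divr_gt0 ?mesh_gt0.
Qed.

Lemma alpha_decr i : (i <= k)%N -> alpha i.+1 < alpha i.
Proof.
case: i => [|i] ik; first by apply: lt_trans (alpha_lt_half _ _) _; rewrite // /alpha; lra.
rewrite !alphaE//; last exact: leqW.
by rewrite -(natr1 i.+1); have := mesh_gt0; lra.
Qed.

Lemma f_ge1 a : 0 < a -> a <= 2^-1 -> 1 <= f a.
Proof. by move=> a0 a2; rewrite -f_half; exact: f_decr. Qed.

Lemma level_lt_inv i : (0 < i < k)%N -> level i <= (alpha i)^-1.
Proof.
case: i => // i /andP[_ ik]; rewrite /level ik.
have a0 : 0 < alpha i.+1 by apply: alpha_gt0; exact: ltnW.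
have fa : f (alpha i.+1) <= (alpha i.+1)^-1.
  by apply: f_le => //; apply: alpha_lt_half => //; apply: leqW; exact: ltnW.
have := ler_wpM2l (_ : 0 <= 1 - mesh) fa; rewrite subr_ge0 (ltW mesh_lt1) => /(_ isT).
by lra.
Qed.

Lemma level_incr i : (i < k)%N -> level i < level i.+1.
Proof.
case: i => [|i] ik.
  have a0 : 0 < alpha 1 by exact: alpha_gt0.
  have a2 : alpha 1 < 2^-1 by exact: alpha_lt_half.
  have f1 := f_ge1 a0 (ltW a2).
  have i1 : 2 < (alpha 1)^-1 by rewrite -[ltLHS]invrK ltf_pV2 ?posrE ?invr_gt0.
  have m0 := mesh_gt0; have m1 := mesh_lt1.
  rewrite /level [(1 < k)%N]isT.
  have := ler_wpM2l (_ : 0 <= 1 - mesh) f1; rewrite subr_ge0 (ltW m1) => /(_ isT).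
  have := ltr_pM2l m0 2 (alpha 1)^-1; rewrite i1; lra.
have a0 : 0 < alpha i.+1 by apply: alpha_gt0; exact: ltnW.
have b0 : 0 < alpha i.+2 by apply: alpha_gt0.
have ba : (alpha i.+1)^-1 < (alpha i.+2)^-1.
  by rewrite ltf_pV2 ?posrE// alpha_decr// ltnW.
have [ik2|ik2] := ltnP i.+2 k; last first.
  apply: le_lt_trans (level_lt_inv _) _; first by rewrite ik.
  by rewrite /level ltnNge ik2.
rewrite /level ik ik2; apply: ler_ltD; last by rewrite ltr_pM2l ?mesh_gt0.
rewrite ler_wpM2l ?subr_ge0 ?(ltW mesh_lt1)//; apply: f_decr => //.
  by apply/ltW/alpha_decr/ltnW.
by apply/ltW/alpha_lt_half => //; apply: leqW; exact: ltnW.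
Qed.

Lemma level_mul i : (i <= k)%N -> level i * alpha i <= 1.
Proof.
case: i => [|i] ik; first by rewrite /level /alpha mulr1.
have a0 := alpha_gt0 ik; rewrite -ler_pdivlMr// div1r.
have [ik2|ik2] := ltnP i.+1 k; first exact: level_lt_inv.
by rewrite /level ltnNge ik2.
Qed.

(** A set of mass at least a has its least element at some i with a <= alpha
    i, which gives the upper bound. For the lower bound take the block that
    starts at the last grid point exceeding a + mesh / 2. *)
Lemma exists_approx : exists g, [/\ hitting_profile g,
  forall a, mesh < a -> a < 2^-1 -> g a <= (1 - mesh) * f a + mesh / a
  & forall a, 0 < a -> a + 2 * mesh <= 2^-1 -> (1 - mesh) * f (a + mesh) <= g a].
Proof.
have alk : alpha k = mesh / 2 by rewrite /alpha subSnn mul1r.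
have [] := @path_profile R k alpha level _ erefl _ alpha_decr _ erefl
  level_incr level_mul _ => //.
- by rewrite /alpha subnn mul0r.
- exact: alpha_lt_half.
- by rewrite /level ltnn mulVf// gt_eqF// alpha_gt0.
move=> g [gP gle gge]; exists g; split => //.
  move=> a ma a2; have m0 := mesh_gt0; have m1 := mesh_lt1.
  have a0 : 0 < a by exact: lt_trans ma.
  have fa := f_ge1 a0 (ltW a2).
  have ia : 1 <= a^-1 by rewrite invf_ge1//; lra.
  have m1' : 0 <= 1 - mesh by lra.
  apply: gle => //; first exact: ltW.
  move=> [|i] ik aai.
    have := ler_wpM2l m1' fa; have := ler_wpM2l (ltW m0) ia; rewrite /level; lra.
  have ik2 : (i.+1 < k)%N.
    rewrite ltn_neqAle ik andbT; apply/eqP => ik'; move: aai; rewrite ik' alk; lra.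
  have ai0 := alpha_gt0 ik.
  rewrite /level ik2 lerD// ler_wpM2l// ?(ltW m0)//; last by rewrite lef_pV2 ?posrE.
  apply: f_decr => //; apply/ltW/alpha_lt_half => //; exact: leqW.
move=> a a0 am; have m0 := mesh_gt0; have m1 := mesh_lt1.
pose m := (Num.truncn (a / (mesh / 2))).+1.
have d0 : 0 < mesh / 2 by rewrite divr_gt0.
have am1 : a < m%:R * (mesh / 2).
  by rewrite -ltr_pdivrMr//; exact: truncnS_gt.
have am2 : m%:R * (mesh / 2) <= a + mesh / 2.
  rewrite /m -(natr1 (Num.truncn _)) mulrDl mul1r lerD2r -ler_pdivlMr//.
  by rewrite truncn_le divr_ge0 // ltW.
have mk : (m < k)%N.
  rewrite -(ltr_nat R) -(ltr_pM2r d0) (le_lt_trans am2)//.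
  have := mesh_mul; rewrite -(natr1 k); lra.
have k0 : (0 < k - m)%N by rewrite subn_gt0.
have kmk : (k - m < k)%N by rewrite /k /m; lia.
have alE : alpha (k - m) = m%:R * (mesh / 2) + mesh / 2.
  rewrite alphaE//; last by apply: leqW; exact: ltnW.
  rewrite natrB; last exact: ltnW.
  by have := mesh_mul; rewrite -(natr1 k); lra.
apply: le_trans (gge a (k - m)%N _ _ _ _) => //; [|lra|by rewrite alE alk; lra].
have ai0 : 0 < alpha (k - m) by apply: alpha_gt0; exact: ltnW.
have -> : level (k - m) = (1 - mesh) * f (alpha (k - m)) + mesh * (alpha (k - m))^-1.
  by move: k0 kmk; case: (k - m)%N => // i _ ik; rewrite /level ik.
have H : f (a + mesh) <= f (alpha (k - m)) by apply: f_decr => //; lra.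
have := ler_wpM2l (_ : 0 <= 1 - mesh) H; rewrite subr_ge0 (ltW m1) => /(_ isT).
have : 0 < mesh * (alpha (k - m))^-1 by rewrite mulr_gt0 ?invr_gt0.
lra.
Qed.

End Level.

(** The points where f drops immediately to the right, witnessed by a rational
    number in the gap; as f decreases, distinct points have distinct
    witnesses. *)
Definition right_jump : set R := [set a | 0 < a < 2^-1 /\
  exists q : rat, ratr q < f a /\ forall b, a < b -> b <= 2^-1 -> f b < ratr q]%classic.

Lemma right_jump_countable : countable right_jump.
Proof.
have [q qP] : exists q : R -> rat, forall a, right_jump a ->
    ratr (q a) < f a /\ forall b, a < b -> b <= 2^-1 -> f b < ratr (q a).
  have H a : exists q : rat, right_jump a ->
      ratr q < f a /\ forall b, a < b -> b <= 2^-1 -> f b < ratr q.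
    have [[_ [q qa]]|no] := pselect (right_jump a); first by exists q.
    by exists 0 => /no.
  by have [q] := choice H; exists q.
apply/countable_injP; exists (pickle \o q) => a b /set_mem ja /set_mem jb.
move=> /(pcan_inj pickleK) qab.
have [a12 _] := ja; have [b12 _] := jb.
have [qa1 qa2] := qP _ ja; have [qb1 qb2] := qP _ jb.
have [ab|ba|//] := ltgtP a b.
  by have := qa2 b ab; rewrite qab; lra.
by have := qb2 a ba; rewrite -qab; lra.
Qed.

Lemma mesh_cvg0 : (mesh @ \oo --> (0 : R))%classic.
Proof.
have -> : mesh = (fun n => @harmonic R (n + 2)%N).
  by apply/funext => n; rewrite addn2.
by rewrite (cvg_shiftn 2 (@harmonic R)); exact: cvg_harmonic.
Qed.

(** Grid approximations evaluate f at a and slightly to its right only, so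
    one-sided continuity suffices. *)
Lemma right_continuity a : 0 < a < 2^-1 -> ~ right_jump a ->
  ((fun n => f (a + mesh n)) @ \oo --> f a)%classic.
Proof.
move=> /andP[a0 a2] nj; apply/cvgrPdist_le => e e0.
have [q /andP[q1 q2]] : exists q : rat, f a - e < ratr q < f a.
  have := @rat_in_itvoo R (f a - e) (f a); rewrite ltrBlDr ltrDl => /(_ e0) [q qP].
  by exists q; move: qP; rewrite in_itv.
have [b [ab [b2 qb]]] : exists b, a < b /\ b <= 2^-1 /\ ratr q <= f b.
  apply: contrapT => no; apply: nj; split; first by rewrite a0.
  exists q; split => // b ab b2; rewrite ltNge; apply/negP => qb; apply: no.
  by exists b.
have bm : 0 < b - a by rewrite subr_gt0.
near=> n.
have m0 := mesh_gt0 n.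
have mb : mesh n < b - a by near: n; apply: (cvgr_lt (0 : R)) bm; exact: mesh_cvg0.
have H1 : f (a + mesh n) <= f a by apply: f_decr => //; lra.
have H2 : f b <= f (a + mesh n) by apply: f_decr => //; lra.
by rewrite ger0_norm; lra.
Unshelve. all: by end_near. Qed.

Lemma bounds_closure : hitting_profile_closure f.
Proof.
split => //; have [g gP] := choice exists_approx.
exists g; split.
- by move=> n; case: (gP n).
- have jn : (@lebesgue_measure R).-negligible right_jump.
    apply/negligibleP; last exact: countable_lebesgue_measure0 right_jump_countable.
    exact: countable_measurable right_jump_countable.
  apply: negligibleS jn => a /= /not_implyP[a02 ncv].
  apply: contrapT => nj; apply: ncv; have /andP[a0 a2] := a02.
  have mc := mesh_cvg0.
  have C0 : ((fun n => 1 - mesh n) @ \oo --> (1 - 0 : R))%classic.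
    by apply: cvgB => //; exact: cvg_cst.
  have C1 : ((fun n => (1 - mesh n) * f (a + mesh n)) @ \oo --> f a)%classic.
    have E : f a = (1 - 0) * f a by ring.
    by rewrite E; apply: cvgM; [exact: C0|exact: right_continuity].
  have C2 : ((fun n => (1 - mesh n) * f a + mesh n / a) @ \oo --> f a)%classic.
    have E : f a = (1 - 0) * f a + 0 * a^-1 by ring.
    by rewrite {2}E; apply: cvgD; apply: cvgMr_tmp; [exact: C0|exact: mc].
  apply: (squeeze_cvgr (f := fun n => (1 - mesh n) * f (a + mesh n))
    (h := fun n => (1 - mesh n) * f a + mesh n / a)) => //; near=> n.
  have [_ gle gge] := gP n; have m0 := mesh_gt0 n.
  apply/andP; split.
    apply: gge => //.
    have : mesh n < (2^-1 - a) / 2.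
      near: n; apply: (cvgr_lt (0 : R)); first exact: mesh_cvg0.
      by rewrite divr_gt0// subr_gt0.
    lra.
  by apply: gle => //; near: n; apply: (cvgr_lt (0 : R)) => //; exact: mesh_cvg0.
- have -> : (fun n => g n 2^-1) = fun=> f 2^-1; last exact: cvg_cst.
  apply/funext => n; have [gn _ _] := gP n.
  by rewrite f_half; case: (hitting_profile_bounds gn).
Unshelve. all: by end_near. Qed.

End Sufficiency.

Theorem theorem1p6 (R : realType) (f : R -> R) (hf : decreasing_half f) :
  hitting_profile_closure f <->
  f 2^-1 = 1 /\ (forall a : R, 0 < a -> a < 2^-1 -> f a <= 1 / a).
Proof.
split; first exact: closure_bounds.
move=> [f_half f_le]; apply: bounds_closure => // a a0 a2.
by rewrite -div1r f_le.
Qed.
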